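(* Let $0<\alpha<2$ and let $Z=Z^{(n)}$ be the sparse random matrix $Z_{ij}=X_{ij}Y_{ij}$, where $X$ is the adjacency matrix of the Erdős–Rényi graph $\mathcal G_{n,d/n}$ and $Y$ has i.i.d. Weibull entries with shape parameter $\alpha$ (all as described in the context). Put $\lambda^{\mathrm{heavy}}_\alpha:=(\log n)^{1/\alpha}$. Then for any $0<\delta<1$, $$\lim_{n\to\infty}\frac{1}{\log n}\left(\log\log\frac{1}{\mathbb P\left(\lambda_1(Z)\le(1-\delta)\lambda^{\mathrm{heavy}}_\alpha\right)}\right)=1-(1-\delta)^\alpha.$$
   Context: $d>0$ is a fixed constant. $X=(X_{ij})_{i,j\in[n]}$ is the adjacency matrix of the Erdős–Rényi graph $\mathcal G_{n,p}$ on vertex set $[n]=\{1,\dots,n\}$ with $p=d/n$. $Y=(Y_{ij})_{i,j\in[n]}$ is a random symmetric matrix, independent of $X$, with $Y_{ii}=0$, $Y_{ij}=Y_{ji}$ and $\{Y_{ij}\}_{1\le i<j\le n}$ i.i.d. with a Weibull distribution with shape parameter $\alpha$ (whose law does not depend on $n$). A random variable $W$ has a Weibull distribution with shape parameter $\alpha>0$ if there exist constants $C_1,C_2>0$ such that for all $t>1$, $\frac{C_1}{2}e^{-t^\alpha}\le \mathbb P(W\ge t)\le\frac{C_2}{2}e^{-t^\alpha}$ and $\frac{C_1}{2}e^{-t^\alpha}\le\mathbb P(W\le -t)\le\frac{C_2}{2}e^{-t^\alpha}$. $Z$ is the entrywise product, $Z_{ij}=X_{ij}Y_{ij}$. $\lambda_1(Z)$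 denotes the largest eigenvalue of the symmetric matrix $Z$. *)

(* Defs.v *)
From HB Require Import structures.
From mathcomp Require Import all_boot all_order all_algebra.
From mathcomp Require Import all_classical all_reals all_analysis.

Set Implicit Arguments.
Unset Strict Implicit.
Unset Printing Implicit Defensive.

Import Order.TTheory GRing.Theory Num.Theory.
Import numFieldNormedType.Exports.

Local Open Scope classical_set_scope.
Local Open Scope ring_scope.

Definition weibull (R : realType) (dT : measure_display) (T : measurableType dT)
    (P : probability T R) (W : {RV P >-> R}) (alpha : R) : Prop :=
  exists C1 C2 : R, [/\ 0 < C1, 0 < C2 &
    forall t : R, 1 < t ->
      ((C1 / 2 * expR (- (t `^ alpha)))%:E <= P [set w | (t <= W w)%R]
         <= (C2 / 2 * expR (- (t `^ alpha)))%:E)%E /\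
      ((C1 / 2 * expR (- (t `^ alpha)))%:E <= P [set w | (W w <= - t)%R]
         <= (C2 / 2 * expR (- (t `^ alpha)))%:E)%E].

Definition mutually_independent (R : realType) (dT : measure_display)
    (T : measurableType dT) (P : probability T R) (I : finType)
    (U : I -> {RV P >-> R}) : Prop :=
  forall (J : {set I}) (B : I -> set R), (forall i, measurable (B i)) ->
    P (\bigcap_(i in [set` J]) (U i @^-1` B i)) =
      (\prod_(i in J) P (U i @^-1` B i))%E.

Definition same_law (R : realType) (d1 d2 : measure_display)
    (T1 : measurableType d1) (T2 : measurableType d2)
    (P1 : probability T1 R) (P2 : probability T2 R)
    (U1 : {RV P1 >-> R}) (U2 : {RV P2 >-> R}) : Prop :=
  forall B : set R, measurable B -> distribution P1 U1 B = distribution P2 U2 B.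

Definition upair (n : nat) := {e : 'I_n * 'I_n | (e.1 < e.2)%N}.

Section RandomMatrix.
Variables (R : realType) (dT : measure_display) (T : measurableType dT).
Variables (P : probability T R) (n : nat).
Implicit Types X Y : 'I_n -> 'I_n -> {RV P >-> R}.

Definition upper X (e : upair n) : {RV P >-> R} := X (val e).1 (val e).2.

Definition sigma_entries X : set (set T) :=
  <<s [set E | exists i j (B : set R), measurable B /\ E = X i j @^-1` B] >>.

Definition independent_matrices X Y : Prop :=
  forall E F, sigma_entries X E -> sigma_entries Y F ->
    P (E `&` F) = (P E * P F)%E.

Definition erdos_renyi_adjacency X (p : R) : Prop :=
  [/\ (forall w i j, X i j w = 0 \/ X i j w = 1),
      (forall w i, X i i w = 0),
      (forall w i j, X i j w = X j i w),
      (forall e : upair n, P [set w | upper X e w = 1] = p%:E) &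
      mutually_independent (upper X)].

Definition iid_symmetric (dO : measure_display) (O : measurableType dO)
    (Q : probability O R) (W : {RV Q >-> R}) Y : Prop :=
  [/\ (forall w i, Y i i w = 0),
      (forall w i j, Y i j w = Y j i w),
      (forall e : upair n, same_law (upper Y e) W) &
      mutually_independent (upper Y)].

Definition entrywise_product X Y (w : T) : 'M[R]_n :=
  \matrix_(i, j) (X i j w * Y i j w).

End RandomMatrix.

(* For symmetric A with n > 0 the set is finite and nonempty, so that the sup
   is a maximum. *)
Definition lambda1 (R : realType) (n : nat) (A : 'M[R]_n) : R :=
  sup [set a : R | eigenvalue A a].

Definition lambda_heavy (R : realType) (alpha : R) (n : nat) : R :=
  ln n%:R `^ (1 / alpha).

(* Main.v *)
Require Import Defs.
From HB Require Import structures.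
From mathcomp Require Import all_boot all_order all_algebra.
From mathcomp Require Import all_classical all_reals all_analysis.
From mathcomp Require Import measurable_realfun ring lra.

(** Write L for log n and theta for (1 - delta)^alpha, so that the threshold
    (1 - delta) L^(1/alpha) is (theta L)^(1/alpha).  A pair of vertices carries
    an entry above the threshold with probability about (d / n) n^(-theta), so
    that about n^(1 - theta) such entries are expected.  Forbidding them costs
    a factor exp (- n^(1 - theta + o(1))), and the theorem holds because nothing
    else has to be paid for.

    The probability is not larger: an off-diagonal entry of a symmetric matrix
    with zero diagonal is at most the largest eigenvalue
    ([entry_le_lambda1]), so the event forces all entries below the threshold,
    and these constraints are independent ([prob_lambda1_le_exp]).

    The probability is not smaller: round |Z_ij|^alpha up to a multiple of a
    unit u, and cap it.  The results live on a finite product space, where decreasing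
    events are positively correlated ([harris]).  Avoiding a family of
    increasing events of probabilities p_i <= 1/2 therefore has probability at
    least exp (- 2 sum_i p_i), and it is enough to find local increasing events
    with sum_i p_i <= n^(1 - theta + o(1)) whose absence forces the bound on the
    largest eigenvalue.  The unit is u = 2 log L, and edges are split into light
    ones, with |Z_ij|^alpha = O(u), and heavy ones.

    - Light part.  If no vertex starts more than L walks of length two, the
      light part has norm at most O(u)^(1/alpha) sqrt L
      ([sqrt_rowsum_form_le]).  This is negligible against L^(1/alpha) exactly
      because alpha < 2.  A Chernoff bound shows that a given vertex violates
      the condition with probability O(1/n) ([pr_degree2]).

    - Heavy part.  Heavy edges are so rare that the heavy graph is a forest with
      small components, outside events whose probabilities sum to O(1).  A tree is
      bipartite, so the norm of a weighted tree is at most the Euclidean norm of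
      its weights h ([tree_form_le]), hence at most (sum h^alpha)^(1/alpha),
      since 2/alpha >= 1.  So the remaining bad events are the heavy trees with
      sum h^alpha >= tau, where tau is slightly below theta L.  The variable
      h^alpha has exponential moments of every order sigma < 1, so each root has
      a bad tree with probability at most about exp (- sigma tau)
      ([pr_heavy_set], [size_trees_le]), and the expected number of bad trees is
      n^(1 - theta + o(1)).

    The two bounds on the probability are [lower_tail_prob_le] and
    [lower_tail_prob_ge]. *)

Set Implicit Arguments.
Unset Strict Implicit.
Unset Printing Implicit Defensive.

Import Order.TTheory GRing.Theory Num.Theory.
Import numFieldNormedType.Exports.

Local Open Scope ring_scope.

(** * Positive correlation on a finite product space *)

Section FiniteProduct.
Variables (R : realFieldType) (E : finType) (m : nat) (q : 'I_m.+1 -> R).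
Hypothesis q_ge0 : forall a, 0 <= q a.
Hypothesis q_sum1 : \sum_a q a = 1.
Local Notation conf := {ffun E -> 'I_m.+1}.
Implicit Types (f g : conf) (F G : conf -> R) (A B : pred conf).

Definition pmass f : R := \prod_e q (f e).
Definition expect F : R := \sum_f pmass f * F f.
Definition pr A : R := expect (fun f => (A f)%:R).

Lemma pmass_ge0 f : 0 <= pmass f.
Proof. by apply: prodr_ge0. Qed.

Lemma expect_prod (phi : E -> 'I_m.+1 -> R) :
  expect (fun f => \prod_e phi e (f e)) = \prod_e \sum_a q a * phi e a.
Proof.
rewrite bigA_distr_bigA; apply: eq_bigr => f _.
by rewrite /pmass -big_split.
Qed.

Lemma expect_const c : expect (fun=> c) = c.
Proof.
rewrite /expect -mulr_suml -(bigA_distr_bigA (fun _ => q)).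
by rewrite q_sum1 big1 // mul1r.
Qed.

Lemma le_expect F G : (forall f, F f <= G f) -> expect F <= expect G.
Proof.
by move=> FG; apply: ler_sum => f _; apply: ler_wpM2l => //; exact: pmass_ge0.
Qed.

Lemma expectZ c F : expect (fun f => c * F f) = c * expect F.
Proof. by rewrite mulr_sumr; apply: eq_bigr => f _; rewrite mulrCA. Qed.

Lemma expect_sum (I : Type) (r : seq I) (P : pred I) (F : I -> conf -> R) :
  expect (fun f => \sum_(i <- r | P i) F i f) = \sum_(i <- r | P i) expect (F i).
Proof.
rewrite /expect exchange_big /=; apply: eq_bigr => f _.
by rewrite mulr_sumr.
Qed.

Lemma pr_ge0 A : 0 <= pr A.
Proof. by apply: sumr_ge0 => f _; rewrite mulr_ge0 ?pmass_ge0. Qed.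

Lemma pr_compl A : pr (predC A) = 1 - pr A.
Proof.
apply/eqP; rewrite -subr_eq0 opprB addrA subr_eq0 -[X in _ == X](expect_const 1).
apply/eqP; rewrite /pr /expect -big_split; apply: eq_bigr => f _ /=.
by rewrite -mulrDr; case: (A f); rewrite /= ?addr0 ?add0r.
Qed.

Definition upd f (e : E) (a : 'I_m.+1) : conf :=
  [ffun e' => if e' == e then a else f e'].

(** Averaging over the coordinate [e].  Composed over all coordinates, these
    operators compute the expectation, so that correlation inequalities reduce to
    one coordinate at a time. *)
Definition resample e F : conf -> R := fun f => \sum_a q a * F (upd f e a).

(** Exchanging the old value of the coordinate with the fresh one is an
    involution that preserves the joint mass. *)
Lemma expect_resample e F : expect (resample e F) = expect F.
Proof.
pose h (x : conf * 'I_m.+1) := (upd x.1 e x.2, x.1 e).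
have hK : involutive h.
  move=> [f a]; rewrite /h /=; congr pair; last by rewrite ffunE eqxx.
  by apply/ffunP => e'; rewrite !ffunE; case: (altP (e' =P e)) => // ->.
have mass f a : pmass (upd f e a) * q (f e) = pmass f * q a.
  rewrite /pmass (bigD1 e) //= [in RHS](bigD1 e) //= ffunE eqxx.
  under eq_bigr => e' ne do rewrite ffunE (negbTE ne).
  by ring.
transitivity (\sum_(x : conf * 'I_m.+1) pmass x.1 * q x.2 * F (upd x.1 e x.2)).
  rewrite -(pair_big predT predT (fun f a => pmass f * q a * F (upd f e a))) /=.
  by apply: eq_bigr => f _; rewrite mulr_sumr; apply: eq_bigr => a _; rewrite mulrA.
under eq_bigr => x _ do rewrite -mass.
rewrite (reindex_inj (inv_inj hK)) /=.
transitivity (\sum_(x : conf * 'I_m.+1) pmass x.1 * q x.2 * F x.1).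
  by apply: eq_bigr => -[f a] _; move: (hK (f, a)); rewrite /h /= => -[-> ->].
rewrite -(pair_big predT predT (fun f a => pmass f * q a * F f)) /=.
apply: eq_bigr => f _.
by rewrite -mulr_suml -mulr_sumr q_sum1 mulr1.
Qed.

Definition decreasing F :=
  forall f g, (forall e, f e <= g e)%N -> F g <= F f.

Lemma decreasing_resample e F : decreasing F -> decreasing (resample e F).
Proof.
move=> dF f g fg; apply: ler_sum => a _; apply: ler_wpM2l => //.
by apply: dF => e'; rewrite !ffunE; case: ifP.
Qed.

(** Expand the nonnegative double sum of
    [w a * w b * ((F a - F b) * (G a - G b))]. *)
Lemma chebyshev_sum (S : finType) (w F G : S -> R) : (forall a, 0 <= w a) ->
    \sum_a w a = 1 -> (forall a b, 0 <= (F a - F b) * (G a - G b)) ->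
  (\sum_a w a * F a) * (\sum_a w a * G a) <= \sum_a w a * (F a * G a).
Proof.
move=> w0 w1 FG.
have : 0 <= \sum_a \sum_b w a * w b * ((F a - F b) * (G a - G b)).
  by do 2!apply: sumr_ge0 => ? _; rewrite mulr_ge0 // mulr_ge0.
set s := \sum_a w a * (F a * G a); set sF := \sum_a w a * F a; set sG := \sum_a w a * G a.
suff -> : \sum_a \sum_b w a * w b * ((F a - F b) * (G a - G b)) =
    2 * (s - sF * sG) by rewrite pmulr_rge0 ?subr_ge0.
have -> : 2 * (s - sF * sG) = s * 1 - sF * sG - sG * sF + 1 * s by ring.
rewrite -w1 /s /sF /sG !big_distrlr /= -!sumrB -!big_split /=.
apply: eq_bigr => a _; rewrite -!sumrB -!big_split /=.
by apply: eq_bigr => b _; ring.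
Qed.

Lemma resample_mul e F G f : decreasing F -> decreasing G ->
  resample e F f * resample e G f <= resample e (fun g => F g * G g) f.
Proof.
move=> dF dG; apply: chebyshev_sum => // a b.
wlog ab : a b / (a <= b)%N.
  by move=> hw; case/orP: (leq_total a b) => /hw //; rewrite -mulrNN !opprB.
apply: mulr_ge0; rewrite subr_ge0; [apply: dF|apply: dG];
  by move=> e'; rewrite !ffunE; case: ifP.
Qed.

Lemma le_resample e F G : (forall f, F f <= G f) ->
  forall f, resample e F f <= resample e G f.
Proof. by move=> FG f; apply: ler_sum => a _; apply: ler_wpM2l. Qed.

Definition resamples (s : seq E) F := foldr resample F s.

Lemma expect_resamples s F : expect (resamples s F) = expect F.
Proof. by elim: s => //= e s IH; rewrite expect_resample. Qed.

Lemma decreasing_resamples s F : decreasing F -> decreasing (resamples s F).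
Proof. by move=> dF; elim: s => //= e s; exact: decreasing_resample. Qed.

Lemma resamples_mul s F G f : decreasing F -> decreasing G ->
  resamples s F f * resamples s G f <= resamples s (fun g => F g * G g) f.
Proof.
move=> dF dG; elim: s f => [|e s IH] f //=.
apply: le_trans (le_resample e IH f).
by apply: resample_mul; exact: decreasing_resamples.
Qed.

(** With [s := enum E] the hypothesis is void, so averaging over all
    coordinates gives a constant, which must be the expectation. *)
Lemma resamples_local s F f g : (forall e, e \notin s -> f e = g e) ->
  resamples s F f = resamples s F g.
Proof.
elim: s f g => [|e s IH] f g fg /=.
  by congr F; apply/ffunP => e; exact: fg.
apply: eq_bigr => a _; congr (_ * _); apply: IH => e' e's; rewrite !ffunE.
by case: eqP => // /eqP ne; apply: fg; rewrite inE negb_or ne.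
Qed.

(** The Harris (FKG) inequality: Chebyshev's inequality in each coordinate, and
    averaging keeps functions decreasing. *)
Lemma harris F G : decreasing F -> decreasing G ->
  expect F * expect G <= expect (fun f => F f * G f).
Proof.
move=> dF dG; pose f0 : conf := [ffun=> ord0].
have cst H : expect H = resamples (enum E) H f0.
  rewrite -(expect_resamples (enum E)) -[RHS]expect_const.
  apply: eq_bigr => f _; congr (_ * _); apply: resamples_local => e.
  by rewrite mem_enum.
by rewrite !cst; exact: resamples_mul.
Qed.

Definition increasing_event A := forall f g, (forall e, f e <= g e)%N -> A f -> A g.

(** The complements of increasing events are decreasing, so avoiding all of them
    is at least as likely as under independence. *)
Lemma pr_avoid_ge (I : Type) (B : I -> pred conf) (r : seq I) :
    (forall i, increasing_event (B i)) ->
  \prod_(i <- r) (1 - pr (B i)) <= pr (fun f => all (fun i => ~~ B i f) r).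
Proof.
move=> incB; elim: r => [|i r IH].
  by rewrite big_nil /= {1}/pr expect_const.
rewrite big_cons /= -pr_compl.
apply: le_trans (ler_wpM2l (pr_ge0 _) IH) _.
apply: le_trans (harris _ _) _.
- move=> f g fg; rewrite ler_nat /=.
  by case: (B i g) (incB i f g fg) => //; case: (B i f) => // /(_ isT).
- move=> f g fg; rewrite ler_nat.
  suff : all (fun j => ~~ B j g) r -> all (fun j => ~~ B j f) r.
    by case: all => // /(_ isT) ->.
  by apply: sub_all => j; apply: contra; exact: incB.
apply: le_expect => f /=.
by rewrite -natrM mulnb.
Qed.

End FiniteProduct.

(** * Growing trees, and quadratic forms supported on forests *)

Section GrownTrees.
Variable V : finType.
Implicit Types (r : V) (s : seq (V * V)).

Definition verts r s : seq V := r :: map snd s.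

Definition exts r s : seq (V * V) :=
  [seq (p, c) | p <- verts r s, c <- enum [predC verts r s]].

(** A tree is recorded by its growth from the root [r]: the list of its (parent,
    child) pairs, the latest first, every child being a new vertex.  A tree has up
    to [k!] such records.  This overcounting, by a factor at most [k] per edge, is
    outweighed by the rarity of heavy edges, as only trees with O(log n) edges
    occur. *)
Fixpoint trees r k : seq (seq (V * V)) :=
  if k is k'.+1 then [seq x :: s | s <- trees r k', x <- exts r s] else [:: [::]].

Lemma extsP r s p c :
  reflect (p \in verts r s /\ c \notin verts r s) ((p, c) \in exts r s).
Proof.
apply: (iffP allpairsP) => [[[p' c']] /= [pv cv [-> ->]]|[pv cv]].
  by rewrite pv; move: cv; rewrite mem_enum inE.
by exists (p, c); rewrite /= mem_enum inE.
Qed.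

Lemma trees_consP r k p c s :
  (p, c) :: s \in trees r k.+1 <->
  [/\ s \in trees r k, p \in verts r s & c \notin verts r s].
Proof.
split=> [/allpairsPdep[s' [x [s't xs' [ex es]]]]|[st pv cv]].
  by rewrite -ex in xs'; rewrite es; have [] := extsP _ _ _ _ xs'.
by apply/allpairsPdep; exists s, (p, c); split=> //; apply/extsP.
Qed.

Lemma size_trees_mem r k s : s \in trees r k -> size s = k.
Proof.
elim: k s => [|k IH] [|[p c] s] //=.
- by case/allpairsPdep => s' [x [_ _ //]].
- by case/trees_consP => /IH ->.
Qed.

Lemma trees_ind (Q : nat -> seq (V * V) -> Prop) r :
    Q 0%N [::] ->
    (forall k p c s, s \in trees r k -> p \in verts r s -> c \notin verts r s ->
       Q k s -> Q k.+1 ((p, c) :: s)) ->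
  forall k s, s \in trees r k -> Q k s.
Proof.
move=> Q0 QS; elim=> [|k IH] s; first by rewrite inE => /eqP ->.
case: s => [|[p c] s] sin; first by have := size_trees_mem sin.
by case/trees_consP: sin => st pv cv; apply: QS => //; exact: IH.
Qed.

Lemma perm_verts_cons r p c s : perm_eq (verts r ((p, c) :: s)) (c :: verts r s).
Proof. by rewrite /verts /= -(cat1s r) -(cat1s c) perm_catCA. Qed.

Lemma verts_uniq r k s : s \in trees r k -> uniq (verts r s).
Proof.
elim/trees_ind: k s / => // k p c s _ _ cv us.
by rewrite (perm_uniq (perm_verts_cons r p c s)) cons_uniq cv.
Qed.

Lemma verts_cons r p c s : verts r ((p, c) :: s) =i c :: verts r s.
Proof. by move=> v; rewrite !inE orbCA. Qed.

Lemma tree_endpoints r k s x :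
  s \in trees r k -> x \in s -> (x.1 \in verts r s) && (x.2 \in verts r s).
Proof.
move=> st; elim/trees_ind: k s / st x => // k p c s _ pv _ IH x.
rewrite inE (verts_cons r p c s x.1) (verts_cons r p c s x.2) !(in_cons c) => /predU1P[->|/IH/andP[-> ->]] /=.
  by rewrite pv eqxx orbT.
by rewrite !orbT.
Qed.

Lemma size_exts_le r s : (size (exts r s) <= (size s).+1 * #|V|)%N.
Proof.
rewrite size_allpairs /verts /= size_map leq_mul2l /= -cardE.
exact: max_card.
Qed.

(** A new pair has at most [k] possible parents, and at most [#|V|] children. *)
Lemma size_trees_le r k : (size (trees r k) <= (k * #|V|) ^ k)%N.
Proof.
suff H j : (j <= k)%N -> (size (trees r j) <= (k * #|V|) ^ j)%N by exact: H.
elim: j => [|j IH] jk //=.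
rewrite size_allpairs_dep sumnE big_map.
apply: (@leq_trans (\sum_(s <- trees r j) (k * #|V|))%N).
  rewrite big_seq [leqRHS]big_seq; apply: leq_sum => s sj.
  apply: leq_trans (size_exts_le _ _) _.
  by rewrite (size_trees_mem sj) leq_mul2r jk orbT.
by rewrite big_const_seq count_predT iter_addn_0 expnS leq_mul2l IH ?orbT // ltnW.
Qed.

Section Heavy.
Variable hv : rel V.

Definition heavy s := all (fun x => hv x.1 x.2) s.

(** Keep adding heavy edges to new vertices.  The growth stops before size [K],
    and then the tree spans a component of the heavy graph. *)
Lemma maximal_tree r K : (forall s, s \in trees r K -> ~~ heavy s) ->
  exists k s, [/\ (k < K)%N, s \in trees r k, heavy s &
    forall i j, i \in verts r s -> hv i j -> j \in verts r s].
Proof.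
move=> noK.
suff H d k s : (K - k = d)%N -> s \in trees r k -> heavy s -> (k <= K)%N ->
  exists k s, [/\ (k < K)%N, s \in trees r k, heavy s &
    forall i j, i \in verts r s -> hv i j -> j \in verts r s].
  by apply: (H K 0%N [::]); rewrite ?subn0 // inE.
elim: d k s => [|d IH] k s dk sk hs kK.
  have /eqP eK : k == K by rewrite eqn_leq kK -subn_eq0 dk.
  by rewrite eK in sk; have := noK _ sk; rewrite hs.
have ltkK : (k < K)%N by rewrite -subn_gt0 dk.
have [/'forall_implyP cl|] := boolP [forall x : V * V,
    (x.1 \in verts r s) && hv x.1 x.2 ==> (x.2 \in verts r s)].
  by exists k, s; split=> // i j iv ij; apply: (cl (i, j)); rewrite /= iv.
rewrite negb_forall => /existsP[[i j]]; rewrite negb_imply /= => /andP[/andP[iv ij] jv].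
apply: (IH k.+1 ((i, j) :: s)) => //=; last by rewrite ij.
  by rewrite subnS dk.
exact/trees_consP.
Qed.

Lemma verts_closed (S : {set V}) r k s :
    (forall i j, i \in S -> hv i j -> j \in S) -> r \in S ->
  s \in trees r k -> heavy s -> {subset verts r s <= S}.
Proof.
move=> clS rS; elim/trees_ind: k s / => [|k p c s _ pv _ IH].
  by move=> _ v; rewrite inE => /eqP ->.
rewrite /heavy /= => /andP[pc /IH sub] v; rewrite verts_cons inE => /predU1P[->|/sub//].
by apply: clS pc; exact: sub.
Qed.

End Heavy.

Section Form.
Variable R : realFieldType.

(** A tree is properly 2-coloured by the parity of the depth.  When a leaf [c]
    gets the colour opposite to its parent [p], the right-hand side gains
    [y c ^+ 2] times the mass of the colour of [p], which is at least
    [y p ^+ 2 * y c ^+ 2]. *)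
Lemma tree_bipartite (y : V -> R) r k s : s \in trees r k ->
  exists col : pred V, \sum_(x <- s) (y x.1) ^+ 2 * (y x.2) ^+ 2 <=
    (\sum_(v <- verts r s | col v) (y v) ^+ 2) *
    (\sum_(v <- verts r s | ~~ col v) (y v) ^+ 2).
Proof.
elim/trees_ind: k s / => [|k p c s _ pv cv [col IH]].
  by exists predT; rewrite big_nil mulr_ge0 //; apply: sumr_ge0 => ? _; rewrite sqr_ge0.
pose col' v := if v == c then ~~ col p else col v.
exists col'; rewrite big_cons /=.
have consE (P : pred V) : \sum_(v <- verts r ((p, c) :: s) | P v) y v ^+ 2 =
    (if P c then y c ^+ 2 else 0) + \sum_(v <- verts r s | P v) y v ^+ 2.
  by rewrite (perm_big _ (perm_verts_cons r p c s)) big_cons; case: ifP; rewrite ?add0r.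
rewrite !consE /col' eqxx.
have same (b : bool) : \sum_(j <- verts r s | b (+) (if j == c then ~~ col p else col j)) y j ^+ 2
    = \sum_(j <- verts r s | b (+) col j) y j ^+ 2.
  rewrite big_seq_cond [RHS]big_seq_cond; apply: eq_bigl => j.
  by case: (altP (j =P c)) => // ->; rewrite (negbTE cv).
have:= same false; have := same true; rewrite /= => -> ->.
set A := \sum_(v <- _ | col v) _ in IH *; set B := \sum_(v <- _ | ~~ col v) _ in IH *.
have A0 : 0 <= A by apply: sumr_ge0 => ? _; rewrite sqr_ge0.
have B0 : 0 <= B by apply: sumr_ge0 => ? _; rewrite sqr_ge0.
have mem_le (P : pred V) : P p -> y p ^+ 2 <= \sum_(v <- verts r s | P v) y v ^+ 2.
  move=> Pp; rewrite (big_rem p pv) /= Pp lerDl; apply: sumr_ge0 => ? _.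
  exact: sqr_ge0.
have [cp|ncp] := boolP (col p); rewrite /=.
- have yA := mem_le _ cp; rewrite add0r mulrDr; apply: lerD => //.
  by apply: ler_wpM2r => //; exact: sqr_ge0.
- have yB := mem_le (fun v => ~~ col v) ncp; rewrite add0r mulrDl; apply: lerD => //.
  by rewrite mulrC; apply: ler_wpM2l => //; exact: sqr_ge0.
Qed.

(** Cauchy-Schwarz over the edges, then the product of the masses of the two
    colours is at most the square of half of the total mass.  Hence the norm of a
    weighted tree is at most the Euclidean norm of the weights of its edges, with
    constant 1. *)
Lemma tree_form_le (y : V -> R) (h : V -> V -> R) (T : R) r k s :
    s \in trees r k -> 0 < T -> \sum_(x <- s) h x.1 x.2 ^+ 2 <= T ^+ 2 ->
  \sum_(x <- s) h x.1 x.2 * (y x.1 * y x.2) *+ 2 <= T * \sum_(v <- verts r s) y v ^+ 2.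
Proof.
move=> st T0 hT; have [col AB] := tree_bipartite y st.
rewrite (bigID col) /=.
move: AB; set A := \sum_(v <- _ | col v) _; set B := \sum_(v <- _ | ~~ col v) _ => AB.
have A0 : 0 <= A by apply: sumr_ge0 => ? _; rewrite sqr_ge0.
have B0 : 0 <= B by apply: sumr_ge0 => ? _; rewrite sqr_ge0.
have [/eqP M0|M0] := boolP (A + B == 0).
  rewrite M0 mulr0; move: M0 AB => /eqP; rewrite paddr_eq0 // => /andP[/eqP -> _].
  rewrite mul0r => S0; rewrite big_seq; apply: sumr_le0 => x xs.
  suff /eqP -> : y x.1 * y x.2 == 0 by rewrite mulr0 mul0rn.
  rewrite -sqrf_eq0 exprMn; apply/eqP/le_anti; rewrite mulr_ge0 ?sqr_ge0 // andbT.
  apply: le_trans S0; rewrite (big_rem x xs) /= lerDl.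
  by apply: sumr_ge0 => z _; rewrite mulr_ge0 ?sqr_ge0.
have {}M0 : 0 < A + B by rewrite lt_neqAle eq_sym M0 addr_ge0.
set mu := (A + B) / 2; have mu0 : 0 < mu by rewrite divr_gt0.
(* Arithmetic-geometric mean with weights that balance T^2 against mu^2. *)
apply: (@le_trans _ _ (\sum_(x <- s) (mu / T * h x.1 x.2 ^+ 2
    + T / mu * (y x.1 ^+ 2 * y x.2 ^+ 2)))).
  apply: ler_sum => x _; set z := y x.1 * y x.2; set g := h _ _.
  rewrite -exprMn -/z -subr_ge0.
  have -> : mu / T * g ^+ 2 + T / mu * z ^+ 2 - g * z *+ 2 =
    (mu * g - T * z) ^+ 2 / (T * mu) by field; rewrite !gt_eqF.
  by rewrite divr_ge0 ?sqr_ge0 // mulr_ge0 // ltW.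
rewrite big_split /= -!mulr_sumr.
have -> : T * (A + B) = mu / T * T ^+ 2 + T / mu * mu ^+ 2.
  by rewrite /mu; field; rewrite !gt_eqF.
apply: lerD; rewrite ler_pM2l ?divr_gt0 //.
apply: le_trans AB _; rewrite -subr_ge0.
have -> : mu ^+ 2 - A * B = ((A - B) / 2) ^+ 2 by rewrite /mu; field.
exact: sqr_ge0.
Qed.

Variables (hv : rel V) (h : V -> V -> R) (T : R) (K : nat).
Hypothesis hv_sym : symmetric hv.
Hypothesis h_sym : forall i j, h i j = h j i.
Hypothesis h_ge0 : forall i j, 0 <= h i j.
Hypothesis h_supp : forall i j, ~~ hv i j -> h i j = 0.
Hypothesis T_gt0 : 0 < T.
Hypothesis no_big_tree : forall r s, s \in trees r K -> ~~ heavy hv s.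
Hypothesis tree_energy : forall r k s, (k < K)%N -> s \in trees r k -> heavy hv s ->
  \sum_(x <- s) h x.1 x.2 ^+ 2 <= T ^+ 2.
Hypothesis no_extra_edge : forall r k s, (k < K)%N -> s \in trees r k -> heavy hv s ->
  forall i j, i \in verts r s -> j \in verts r s -> hv i j -> (i, j) \in s \/ (j, i) \in s.

(** The components of the heavy graph are removed one after the other.  Each is
    spanned by a tree that has all its heavy edges, by [no_extra_edge], so that
    [tree_form_le] bounds its contribution. *)
Lemma heavy_form_le (y : V -> R) : (forall v, 0 <= y v) ->
  \sum_i \sum_j h i j * (y i * y j) <= T * \sum_i y i ^+ 2.
Proof.
move=> y0.
have term0 i j : 0 <= h i j * (y i * y j) by rewrite !mulr_ge0.
suff H d (S : {set V}) : #|S| = d -> (forall i j, i \in S -> hv i j -> j \in S) ->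
    \sum_(i in S) \sum_(j in S) h i j * (y i * y j) <= T * \sum_(i in S) y i ^+ 2.
  have := H _ [set: V] erefl (fun i j _ _ => finset.in_setT j).
  rewrite (eq_bigl predT) => [|i]; last by rewrite inE.
  rewrite [X in _ * X](eq_bigl predT) => [|i]; last by rewrite inE.
  congr (_ <= _); apply: eq_bigr => i _; apply: eq_bigl => j; by rewrite inE.
elim/ltn_ind: d S => d IH S dS clS.
have [->|[r rS]] := finset.set_0Vmem S; first by rewrite !big_set0 mulr0.
have [k [s [kK st hs clV]]] := maximal_tree (no_big_tree (r := r)).
pose W := [set v in verts r s].
have WS : W \subset S.
  by apply/fintype.subsetP => v; rewrite inE; exact: verts_closed clS rS st hs v.
have clW i j : i \in W -> hv i j -> j \in W by rewrite !inE; exact: clV.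
have IHS : \sum_(i in S :\: W) \sum_(j in S :\: W) h i j * (y i * y j)
    <= T * \sum_(i in S :\: W) y i ^+ 2.
  apply: (IH #|S :\: W|) => //.
    rewrite -dS; apply: proper_card; apply/properP; split; first exact: finset.subsetDl.
    by exists r => //; rewrite !inE eqxx.
  move=> i j; rewrite !finset.in_setD => /andP[iW iS] ij.
  rewrite (clS i j) // andbT; apply: contra iW => jW.
  by have := clW j i jW; rewrite hv_sym ij; exact.
have crossW i j : i \in W -> j \notin W -> h i j = 0.
  move=> iW jW; apply: h_supp; apply: contra jW; exact: clW.
have splitS (f : V -> R) : \sum_(i in S) f i = \sum_(i in W) f i + \sum_(i in S :\: W) f i.
  rewrite (big_setID W) /=; congr (_ + _); apply: eq_bigl => i.
  by rewrite (finset.setIidPr WS).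
rewrite !splitS mulrDr; apply: lerD; last first.
  apply: le_trans IHS; apply: ler_sum => i; rewrite inE => /andP[iW _].
  rewrite splitS gerDr; apply: sumr_le0 => j jW.
  by rewrite h_sym crossW ?mul0r.
have WE (f : V -> R) : \sum_(i in W) f i = \sum_(v <- verts r s) f v.
  rewrite (big_uniq _ (verts_uniq st)) /=; apply: eq_bigl => i; by rewrite inE.
rewrite [X in _ * X]WE.
apply: le_trans (tree_form_le y st T_gt0 (tree_energy kK st hs)).
apply: (@le_trans _ _ (\sum_(i in W) \sum_(j in W) \sum_(x <- s)
    h x.1 x.2 * (y x.1 * y x.2) * ((x == (i, j)) + (x == (j, i)))%:R)).
  apply: ler_sum => i iW; rewrite splitS [X in _ + X]big1 ?addr0; last first.
    by move=> j; rewrite inE => /andP[jW _]; rewrite crossW ?mul0r.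
  apply: ler_sum => j jW.
  have t0 (x : V * V) : 0 <= h x.1 x.2 * (y x.1 * y x.2) * ((x == (i, j)) + (x == (j, i)))%:R.
    by rewrite mulr_ge0.
  have [hij|/h_supp ->] := boolP (hv i j); last first.
    by rewrite mul0r; apply: sumr_ge0 => x _.
  have [ijs|jis] : (i, j) \in s \/ (j, i) \in s.
    by apply: (no_extra_edge kK st hs) => //; [move: iW|move: jW]; rewrite inE.
  - rewrite (big_rem _ ijs) /= eqxx; apply: ler_wpDr; first exact: sumr_ge0.
    by rewrite ler_peMr // ler1n.
  - rewrite (big_rem _ jis) /= eqxx addnC; apply: ler_wpDr; first exact: sumr_ge0.
    by rewrite h_sym [y j * _]mulrC ler_peMr ?ler1n // !mulr_ge0.
under eq_bigr => i _ do rewrite exchange_big /=.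
rewrite exchange_big /= big_seq [leRHS]big_seq; apply: ler_sum => x xs.
under eq_bigr => i _ do rewrite -mulr_sumr.
rewrite -mulr_sumr -mulr_natr; apply: ler_wpM2l => //.
under eq_bigr => i _ do rewrite -natr_sum.
rewrite -natr_sum ler_nat.
under eq_bigr => i _ do rewrite big_split /=.
rewrite big_split /=.
have one (u v : V) : (\sum_(i in W) \sum_(j in W) ((u, v) == (i, j)) <= 1)%N.
  rewrite pair_big /=; apply: (@leq_trans (\sum_(z : V * V) ((u, v) == z))).
    rewrite big_mkcond; apply: leq_sum => -[i j] _ /=; by case: ifP.
  rewrite (bigD1 (u, v)) //= eqxx big1 // => z; by rewrite eq_sym => /negbTE ->.
have := leq_add (one x.1 x.2) (one x.2 x.1); apply: leq_trans.
apply: leq_add; apply: leq_sum => i _; apply: leq_sum => j _.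
  by case: (x).
by rewrite xpair_eqE; case: (x) => a b; rewrite xpair_eqE andbC.
Qed.

End Form.
End GrownTrees.

(** * The largest eigenvalue and quadratic forms *)

Section QuadraticForm.
Local Open Scope classical_set_scope.
Local Open Scope ring_scope.
Variables (R : realType) (n : nat).
Implicit Types (A B : 'M[R]_n) (x z : 'rV[R]_n).

Definition bform A x z : R := (x *m A *m z^T) 0 0.
Definition qform A x : R := bform A x x.
Definition sqnorm x : R := qform 1%:M x.

Lemma bformE A x z : bform A x z = \sum_i \sum_j A i j * (x 0 i * z 0 j).
Proof.
rewrite /bform mxE exchange_big /=; apply: eq_bigr => j _.
rewrite !mxE big_distrl /=; apply: eq_bigr => i _.
by rewrite mulrAC mulrC mulrA.
Qed.

Lemma sqnormE x : sqnorm x = \sum_i x 0 i ^+ 2.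
Proof.
rewrite /sqnorm /qform /bform mulmx1 mxE; apply: eq_bigr => i _.
by rewrite mxE expr2.
Qed.

Lemma sqnorm_ge0 x : 0 <= sqnorm x.
Proof. by rewrite sqnormE; apply: sumr_ge0 => i _; exact: sqr_ge0. Qed.

Lemma sqnorm_gt0 x : x != 0 -> 0 < sqnorm x.
Proof.
move=> x0; rewrite lt_neqAle sqnorm_ge0 andbT eq_sym; apply: contra x0.
rewrite sqnormE psumr_eq0 => [/allP x0|i _]; last exact: sqr_ge0.
apply/eqP/rowP => i; rewrite mxE; apply/eqP.
by have := x0 i (mem_index_enum _); rewrite /= sqrf_eq0.
Qed.

Lemma bformDl A x y z : bform A (x + y) z = bform A x z + bform A y z.
Proof. by rewrite /bform !mulmxDl mxE. Qed.
Lemma bformDr A x y z : bform A x (y + z) = bform A x y + bform A x z.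
Proof. by rewrite /bform raddfD /= mulmxDr mxE. Qed.
Lemma bformZl A a x z : bform A (a *: x) z = a * bform A x z.
Proof. by rewrite /bform -!scalemxAl mxE. Qed.
Lemma bformZr A a x z : bform A x (a *: z) = a * bform A x z.
Proof. by rewrite /bform linearZ -scalemxAr mxE. Qed.
Lemma bform_sym A x z : A^T = A -> bform A x z = bform A z x.
Proof.
move=> sA; transitivity ((x *m A *m z^T)^T 0 0); first by rewrite mxE.
by rewrite !trmx_mul trmxK sA mulmxA.
Qed.

Lemma qformZ A a x : qform A (a *: x) = a ^+ 2 * qform A x.
Proof. by rewrite /qform bformZl bformZr mulrA expr2. Qed.

Lemma qform_sub_scalar A c x : qform (c%:M - A) x = c * sqnorm x - qform A x.
Proof.
by rewrite /sqnorm /qform /bform mulmxBr mulmxBl mul_mx_scalar -scalemxAl mulmx1 !mxE.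
Qed.

Lemma qform_le_const A : exists2 M, 0 < M & forall x, qform A x <= M * sqnorm x.
Proof.
exists (1 + \sum_i \sum_j `|A i j|).
  by rewrite ltr_pwDl // !sumr_ge0 // => i _; rewrite sumr_ge0.
move=> x; rewrite mulrDl mul1r; apply: ler_wpDl; first exact: sqnorm_ge0.
rewrite /qform bformE mulr_suml; apply: ler_sum => i _.
rewrite mulr_suml; apply: ler_sum => j _.
apply: le_trans (ler_norm _) _; rewrite normrM; apply: ler_wpM2l => //.
have sq_le k : x 0 k ^+ 2 <= sqnorm x.
  rewrite sqnormE (bigD1 k) //= lerDl; apply: sumr_ge0 => ? _; exact: sqr_ge0.
have := sq_le i; have := sq_le j; have := sqr_ge0 (`|x 0 i| - `|x 0 j|).
rewrite normrM sqrrB !real_normK ?num_real //; lra.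
Qed.

(** With [z := x *m B], nonnegativity of the form at [x - M^-1 *: z] bounds
    [sqnorm z] by [M * qform B x], and [sqnorm x] is controlled by [sqnorm z]
    through the inverse of [B]. *)
Lemma qform_unit_coercive B : B^T = B -> (forall x, 0 <= qform B x) -> B \in unitmx ->
  exists2 e, 0 < e & forall x, e * sqnorm x <= qform B x.
Proof.
move=> sB B0 uB.
have [M M0 HM] := qform_le_const B.
have [M' M'0 HM'] := qform_le_const (invmx B *m (invmx B)^T).
exists (M * M')^-1; first by rewrite invr_gt0 mulr_gt0.
move=> x; rewrite mulrC ler_pdivrMr ?mulr_gt0 //.
pose z := x *m B.
have xz : bform B x z = sqnorm z by rewrite /sqnorm /qform /bform mulmx1.
have zx : sqnorm x <= M' * sqnorm z.
  suff -> : sqnorm x = qform (invmx B *m (invmx B)^T) z by exact: HM'.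
  rewrite /sqnorm /qform /bform mulmx1.
  have -> : x = z *m invmx B by rewrite /z mulmxK.
  by rewrite trmx_mul !mulmxA.
have := B0 (x + (- M^-1) *: z).
rewrite /qform bformDl !bformDr bformZl !bformZr bformZl (bform_sym z x) // xz.
rewrite -/(qform B z) -/(qform B x) => H.
have zz : M^-1 * (M^-1 * qform B z) <= M^-1 * sqnorm z.
  by rewrite ler_pM2l ?invr_gt0 // mulrC ler_pdivrMr // mulrC.
have {H} : M^-1 * sqnorm z <= qform B x by lra.
rewrite mulrC ler_pdivrMr // => H.
apply: le_trans zx _.
have -> : qform B x * (M * M') = M' * (qform B x * M) by ring.
by rewrite ler_pM2l.
Qed.

Lemma eigenvalue_qform A a : eigenvalue A a ->
  exists2 x, x != 0 & qform A x = a * sqnorm x.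
Proof.
move/eigenvalueP => [v vA v0]; exists v => //.
by rewrite /sqnorm /qform /bform vA mulmx1 -scalemxAl mxE.
Qed.

Lemma lambda1_le A t : 0 <= t -> (forall x, qform A x <= t * sqnorm x) ->
  lambda1 A <= t.
Proof.
move=> t0 At; rewrite /lambda1.
have [->|/set0P ne] := eqVneq [set a | eigenvalue A a] set0; first by rewrite sup0.
apply: ge_sup => // a /= /eigenvalue_qform[x x0 xA].
by have := At x; rewrite xA ler_pM2r // sqnorm_gt0.
Qed.

(** Let [c] be the supremum of the form over unit vectors.  If [c] were not an
    eigenvalue, [c%:M - A] would be nonnegative and invertible, hence coercive, and
    [c] could be lowered.  So [c] is an eigenvalue, and it is the largest. *)
Lemma qform_le_lambda1 A x : A^T = A -> qform A x <= lambda1 A * sqnorm x.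
Proof.
move=> sA; have [->|x0] := eqVneq x 0.
  by rewrite /sqnorm /qform /bform !mul0mx !mxE mulr0.
pose E := [set qform A y | y in [set y | sqnorm y = 1]].
pose nrm y := (Num.sqrt (sqnorm y))^-1 *: y.
have nrmE y : y != 0 -> E (qform A y / sqnorm y).
  move=> y0; exists (nrm y) => /=.
    rewrite /sqnorm /nrm qformZ -/(sqnorm y) exprVn sqr_sqrtr ?sqnorm_ge0 //.
    by rewrite mulVf // gt_eqF // sqnorm_gt0.
  by rewrite /nrm qformZ exprVn sqr_sqrtr ?sqnorm_ge0 // mulrC.
have hE : has_sup E.
  split; first by exists (qform A x / sqnorm x); exact: nrmE.
  have [M _ HM] := qform_le_const A; exists M => _ [y /= y1 <-].
  by rewrite (le_trans (HM y)) // y1 mulr1.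
pose c := sup E.
have Ac y : qform A y <= c * sqnorm y.
  have [->|y0] := eqVneq y 0.
    by rewrite /sqnorm /qform /bform !mul0mx !mxE mulr0.
  rewrite -ler_pdivrMr ?sqnorm_gt0 //; apply: sup_upper_bound => //; exact: nrmE.
have eigc : eigenvalue A c.
  case: (boolP (eigenvalue A c)) => // nc; exfalso.
  pose B := c%:M - A.
  have uB : B \in unitmx.
    rewrite -row_free_unit -kermx_eq0.
    have /eqP k0 : kermx (A - c%:M) == 0 by apply: negbNE; exact: nc.
    apply/eqP/row_matrixP => i; apply/eqP.
    have : (row i (kermx B) <= kermx (A - c%:M))%MS.
      apply/sub_kermxP; rewrite -opprB mulmxN.
      by rewrite -row_mul mulmx_ker row0 oppr0.
    by rewrite k0 submx0 row0.
  have sB : B^T = B by rewrite /B raddfB /= tr_scalar_mx sA.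
  have [y|e e0 He] := qform_unit_coercive sB _ uB.
    by rewrite qform_sub_scalar subr_ge0.
  have : c <= c - e.
    apply: ge_sup; first exact: hE.1.
    move=> _ [y /= y1 <-]; have := He y.
    rewrite qform_sub_scalar y1; lra.
  lra.
apply: le_trans (Ac x) _; rewrite ler_pM2r ?sqnorm_gt0 //.
apply: sup_upper_bound => //; split; first by exists c.
exists c => a /= /eigenvalue_qform[y y0 yA].
by have := Ac y; rewrite yA ler_pM2r // sqnorm_gt0.
Qed.

Lemma lambda1_leP A t : A^T = A -> 0 <= t ->
  (lambda1 A <= t) <-> (forall x, qform A x <= t * sqnorm x).
Proof.
move=> sA t0; split; last exact: lambda1_le.
move=> At x; apply: le_trans (qform_le_lambda1 x sA) _.
by rewrite ler_wpM2r // sqnorm_ge0.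
Qed.

Lemma bform_le_entries A x z (a b : 'I_n -> R) :
    (forall i, `|x 0 i| <= a i) -> (forall i, `|z 0 i| <= b i) ->
  `|bform A x z| <= \sum_i \sum_j `|A i j| * (a i * b j).
Proof.
move=> xa zb; rewrite bformE; apply: le_trans (ler_norm_sum _ _ _) _.
apply: ler_sum => i _; apply: le_trans (ler_norm_sum _ _ _) _.
by apply: ler_sum => j _; rewrite !normrM ler_wpM2l // ler_pM.
Qed.

(** At the integer part of [k *: x] the form is [k ^+ 2 * qform B x + O(k)], so a
    negative value at [x] would be detected by integer vectors for large [k]. *)
Lemma qform_ge0_int B :
    (forall z : 'rV[int]_n, 0 <= qform B (map_mx intr z)) ->
  forall x, 0 <= qform B x.
Proof.
move=> Bz x; rewrite leNgt; apply/negP => Bx.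
pose C := \sum_i \sum_j `|B i j| * (`|x 0 i| * 1) +
  \sum_i \sum_j `|B i j| * (1 * `|x 0 j|) + \sum_i \sum_j `|B i j| * (1 * 1).
suff H k : (0 < k)%N -> k%:R * (- qform B x) <= C.
  have := H (Num.truncn (C / - qform B x)).+1 isT.
  by rewrite -ler_pdivlMr ?oppr_gt0 // leNgt truncnS_gt.
move=> k0; pose z : 'rV[int]_n := \row_i Num.floor (k%:R * x 0 i).
pose r : 'rV[R]_n := map_mx intr z - k%:R *: x.
have r1 i : `|r 0 i| <= 1.
  rewrite !mxE; have := Num.Theory.floor_itv (k%:R * x 0 i).
  by rewrite intrD => /andP[? ?]; rewrite ler_norml; lra.
have := Bz z; have -> : map_mx intr z = k%:R *: x + r by rewrite /r addrC subrK.
clearbody r.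
rewrite /qform bformDl !bformDr bformZl !bformZr bformZl.
have h1 := bform_le_entries B (fun i => lexx `|x 0 i|) r1.
have h2 := bform_le_entries B r1 (fun i => lexx `|x 0 i|).
have h3 := bform_le_entries B r1 r1.
have k1 : 1 <= k%:R :> R by rewrite ler1n.
move: h1 h2 h3; rewrite /C; set S1 := \sum_i _; set S2 := \sum_i _; set S3 := \sum_i _.
rewrite /qform; move: (bform B x r) (bform B r x) (bform B r r) (bform B x x).
move=> b1 b2 b3 b; rewrite !ler_norml => /andP[_ h1] /andP[_ h2] /andP[h30 h3].
have S30 : 0 <= S3 by lra.
move=> H; rewrite -(ler_pM2l (lt_le_trans ltr01 k1)).
have : k%:R * b1 <= k%:R * S1 by rewrite ler_wpM2l.
have : k%:R * b2 <= k%:R * S2 by rewrite ler_wpM2l.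
have : 1 * S3 <= k%:R * S3 by rewrite ler_wpM2r.
lra.
Qed.

(** Countably many conditions, each polynomial in the entries: this gives the
    measurability of the event in a random matrix. *)
Lemma lambda1_le_intP A t : A^T = A -> 0 <= t ->
  (lambda1 A <= t) <->
  (forall z : 'rV[int]_n, qform A (map_mx intr z) <= t * sqnorm (map_mx intr z)).
Proof.
move=> sA t0; rewrite lambda1_leP //; split=> [H z|H x]; first exact: H.
rewrite -subr_ge0 -qform_sub_scalar; apply: qform_ge0_int => z.
by rewrite qform_sub_scalar subr_ge0.
Qed.

(** Evaluate the form on the sum of two basis vectors. *)
Lemma entry_le_lambda1 A t i j : A^T = A -> 0 <= t -> (forall k, A k k = 0) ->
  lambda1 A <= t -> i != j -> A i j <= t.
Proof.
move=> sA t0 dA /(lambda1_leP sA t0) H ij.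
have := H (delta_mx 0 i + delta_mx 0 j).
have E (B : 'M[R]_n) k l : bform B (delta_mx 0 k) (delta_mx 0 l) = B k l.
  by rewrite /bform -rowE trmx_delta -colE !mxE.
rewrite /sqnorm /qform !bformDl !bformDr !E !dA !mxE !eqxx (negbTE ij) eq_sym (negbTE ij) /=.
have -> : A j i = A i j by rewrite -[in LHS]sA mxE.
lra.
Qed.

End QuadraticForm.

(** * Quadratic forms of matrices without bad local configurations *)

(** The hypothesis bounds the row sums of the square of [A], hence
    |A y|^2 <= M |y|^2; conclude by Cauchy-Schwarz. *)
Lemma sqrt_rowsum_form_le (R : rcfType) (V : finType) (A : V -> V -> R) (M : R) (y : V -> R) :
    (forall i j, 0 <= A i j) -> (forall i j, A i j = A j i) -> 0 < M ->
    (forall i, \sum_j \sum_k A i j * A j k <= M) ->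
  \sum_i \sum_j A i j * (y i * y j) <= Num.sqrt M * \sum_i y i ^+ 2.
Proof.
move=> A0 sA M0 AM; set s := Num.sqrt M; set Y := \sum_i _ ^+ 2.
have s0 : 0 < s by rewrite sqrtr_gt0.
have sM : s * s = M by rewrite -expr2 sqr_sqrtr // ltW.
pose z i := \sum_j A i j * y j.
have zz : \sum_i z i ^+ 2 <= M * Y.
  have -> : \sum_i z i ^+ 2 = \sum_j \sum_k (\sum_i A j i * A i k) * (y j * y k).
    under eq_bigr => i _ do rewrite /z expr2 big_distrlr /=.
    rewrite exchange_big /=; apply: eq_bigr => j _.
    rewrite exchange_big /=; apply: eq_bigr => k _.
    by rewrite big_distrl /=; apply: eq_bigr => i _; rewrite (sA j i); ring.
  pose B j k := \sum_i A j i * A i k.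
  have B0 j k : 0 <= B j k by apply: sumr_ge0 => i _; rewrite mulr_ge0.
  have sB j k : B j k = B k j.
    by apply: eq_bigr => i _; rewrite (sA j i) (sA i k) mulrC.
  have BM j : \sum_k B j k <= M by rewrite /B exchange_big /=; exact: AM.
  apply: (@le_trans _ _ (\sum_j \sum_k B j k * (y j ^+ 2 + y k ^+ 2) / 2)).
    apply: ler_sum => j _; apply: ler_sum => k _; rewrite -mulrA -/(B j k).
    apply: ler_wpM2l => //.
    by have := sqr_ge0 (y j - y k); rewrite sqrrB; lra.
  have -> : \sum_j \sum_k B j k * (y j ^+ 2 + y k ^+ 2) / 2 =
      \sum_j (\sum_k B j k) * y j ^+ 2.
    transitivity ((\sum_j \sum_k B j k * y j ^+ 2 + \sum_j \sum_k B j k * y k ^+ 2) / 2).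
      rewrite -big_split mulr_suml; apply: eq_bigr => j _ /=.
      rewrite -big_split mulr_suml; apply: eq_bigr => k _ /=; by rewrite mulrDr.
    have -> : \sum_j \sum_k B j k * y k ^+ 2 = \sum_j \sum_k B j k * y j ^+ 2.
      by rewrite exchange_big; apply: eq_bigr => j _; apply: eq_bigr => k _; rewrite sB.
    have -> (x : R) : (x + x) / 2 = x by lra.
    by apply: eq_bigr => j _; rewrite mulr_suml.
  by rewrite mulr_sumr; apply: ler_sum => j _; rewrite ler_wpM2r ?sqr_ge0.
have -> : \sum_i \sum_j A i j * (y i * y j) = \sum_i y i * z i.
  apply: eq_bigr => i _; rewrite mulr_sumr; apply: eq_bigr => j _; ring.
have : \sum_i (s * y i - z i) ^+ 2 = M * Y - 2 * s * (\sum_i y i * z i) + \sum_i z i ^+ 2.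
  rewrite /Y -sM !mulr_sumr -sumrB -big_split; apply: eq_bigr => i _ /=; ring.
have : 0 <= \sum_i (s * y i - z i) ^+ 2 by apply: sumr_ge0 => i _; exact: sqr_ge0.
move=> h0 h; rewrite -(ler_pM2l s0) mulrA sM; lra.
Qed.

Section StateMatrix.
Variables (R : realType) (V : finType) (g : V -> V -> nat) (N m : nat).
Variables (u tau L alpha : R).
Hypothesis g_sym : forall i j, g i j = g j i.
Hypothesis g_diag : forall i, g i i = 0%N.
Hypotheses (u_gt0 : 0 < u) (tau_gt0 : 0 < tau) (L_gt0 : 0 < L).
Hypotheses (alpha_gt0 : 0 < alpha) (alpha_lt2 : alpha < 2).
Hypotheses (Nm : (N < m)%N) (mu_tau : tau <= m%:R * u).

Definition heavy_edge : rel V := fun i j => (N < g i j)%N.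

Hypothesis light_trees : forall r k s, (k <= m)%N -> s \in trees r k ->
  heavy heavy_edge s -> u * (\sum_(x <- s) g x.1 x.2)%:R < tau.
Hypothesis no_cycle : forall r k s, (k < m)%N -> s \in trees r k ->
  heavy heavy_edge s -> forall i j, i \in verts r s -> j \in verts r s ->
  heavy_edge i j -> (i, j) \in s \/ (j, i) \in s.
Hypothesis two_step_degree : forall i,
  \sum_j \sum_k ((0 < g i j)%N%:R * (0 < g j k)%N%:R) <= L.

(** A single edge of state at least [m] would already be a tree that reaches
    [tau]. *)
Lemma state_lt i j : (g i j < m)%N.
Proof.
rewrite ltnNge; apply/negP => mg.
have m0 : (0 < m)%N by exact: leq_ltn_trans Nm.
have ij : i != j by apply: contraTneq mg => ->; rewrite g_diag -ltnNge.
have tij : [:: (i, j)] \in trees i 1.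
  by apply/trees_consP; split; rewrite ?inE // eq_sym.
have := light_trees m0 tij; rewrite /heavy /= /heavy_edge (leq_trans Nm mg) big_seq1.
move=> /(_ isT); rewrite /= ltNge => /negP; apply.
by rewrite mulrC (le_trans mu_tau) // ler_wpM2r ?ler_nat // ltW.
Qed.

(** Entries of state at most [N] are dominated by a multiple of the adjacency
    matrix, to which [sqrt_rowsum_form_le] applies; the others are supported on
    a forest, to which [heavy_form_le] applies.  The energy of a tree is bounded
    by sum w^(2/alpha) <= (sum w)^(2/alpha), which uses 2/alpha >= 1. *)
Lemma state_form_le (y : V -> R) : (forall v, 0 <= y v) ->
  \sum_i \sum_j (u * (g i j)%:R) `^ alpha^-1 * (y i * y j) <=
  ((N%:R * u) `^ alpha^-1 * Num.sqrt L + tau `^ alpha^-1) * \sum_i y i ^+ 2.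
Proof.
move=> y0.
pose A i j : R := (0 < g i j)%N%:R.
pose w i j := (u * (g i j)%:R) `^ alpha^-1.
pose H i j := if heavy_edge i j then w i j else 0.
have ia0 : 0 < alpha^-1 by rewrite invr_gt0.
apply: (@le_trans _ _ (\sum_i \sum_j ((N%:R * u) `^ alpha^-1 * (A i j * (y i * y j))
     + H i j * (y i * y j)))).
  apply: ler_sum => i _; apply: ler_sum => j _; rewrite [X in _ <= X + _]mulrA -mulrDl.
  apply: ler_wpM2r; first by rewrite mulr_ge0.
  rewrite /H /A /heavy_edge -/(w i j); case: (ltnP N) => [_|gN].
    by rewrite lerDr mulr_ge0 ?powR_ge0.
  rewrite addr0; case: posnP => [g0|_].
    by rewrite /w g0 mulr0 powR0 ?gt_eqF // mulr0.
  rewrite mulr1 /w ge0_ler_powR ?(ltW ia0) ?nnegrE ?mulr_ge0 ?(ltW u_gt0) //.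
  by rewrite mulrC ler_wpM2r ?(ltW u_gt0) // ler_nat.
under eq_bigr => i _ do rewrite big_split /= -mulr_sumr.
rewrite big_split /= -mulr_sumr mulrDl -mulrA; apply: lerD.
  apply: ler_wpM2l; first exact: powR_ge0.
  by apply: sqrt_rowsum_form_le => // i j; rewrite /A g_sym.
have hvs : symmetric heavy_edge by move=> i j; rewrite /heavy_edge g_sym.
have hcount s : heavy heavy_edge s -> (size s <= \sum_(x <- s) g x.1 x.2)%N.
  elim: s => //= x s IH; rewrite /heavy /= => /andP[hx hs]; rewrite big_cons.
  by rewrite -add1n leq_add ?IH // (leq_trans _ hx).
apply: (@heavy_form_le _ _ heavy_edge H _ m) => //.
- by move=> i j; rewrite /H hvs /w g_sym.
- by move=> i j; rewrite /H; case: ifP => // _; exact: powR_ge0.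
- by move=> i j; rewrite /H => /negbTE ->.
- by rewrite powR_gt0.
- move=> r s st; apply/negP => hs.
  have := light_trees (leqnn m) st hs; rewrite ltNge => /negP; apply.
  rewrite (le_trans mu_tau) // mulrC ler_wpM2l ?(ltW u_gt0) // ler_nat.
  by rewrite -[X in (X <= _)%N](size_trees_mem st) hcount.
- move=> r k s km st hs.
  have := ltW (light_trees (ltnW km) st hs); rewrite natr_sum mulr_sumr => sum_tau.
  have c1 : 0 <= 2 / alpha - 1 by rewrite subr_ge0 ler_pdivlMr // mul1r ltW.
  have sq (t : R) : 0 < t -> (t `^ alpha^-1) ^+ 2 = t * t `^ (2 / alpha - 1).
    move=> t0; rewrite -powR_mulrn ?powR_ge0 // -powRrM mulrC.
    transitivity (t `^ 1 * t `^ (2 / alpha - 1)); last by rewrite powRr1 // ltW.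
    rewrite -powRD ?(gt_eqF t0) ?implybT //.
    by congr (_ `^ _); lra.
  rewrite (sq _ tau_gt0).
  apply: (@le_trans _ _ (\sum_(x <- s) u * (g x.1 x.2)%:R * tau `^ (2 / alpha - 1))).
    rewrite big_seq [leRHS]big_seq; apply: ler_sum => x xs.
    have hx : heavy_edge x.1 x.2 by move/allP: hs => /(_ x xs).
    have gx : 0 < u * (g x.1 x.2)%:R.
      by rewrite mulr_gt0 // ltr0n (leq_ltn_trans _ hx).
    rewrite /H hx /w sq // ler_wpM2l ?(ltW gx) //.
    rewrite ge0_ler_powR ?nnegrE ?(ltW gx) ?(ltW tau_gt0) //.
    apply: le_trans sum_tau; rewrite (big_rem x xs) /= lerDl.
    by apply: sumr_ge0 => z _; rewrite mulr_ge0 ?(ltW u_gt0).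
  by rewrite -mulr_suml ler_wpM2r ?powR_ge0.
Qed.

End StateMatrix.

(** * Edges as sets of unordered pairs *)

Section PairEdges.
Variable n : nat.
Implicit Types (i j : 'I_n) (e : upair n) (s : seq ('I_n * 'I_n)).

(** A singleton if [i != j] and empty otherwise.  Sets spare the choice of an
    orientation for each pair of vertices. *)
Definition edge_set i j : {set upair n} :=
  [set e | (val e == (i, j)) || (val e == (j, i))].

Lemma edge_setC i j : edge_set i j = edge_set j i.
Proof. by apply/setP => e; rewrite !inE orbC. Qed.

Lemma edge_set_diag i : edge_set i i = finset.set0.
Proof.
apply/setP => e; rewrite !inE orbb; apply/negP => /eqP h.
by have := valP e; rewrite /= h ltnn.
Qed.

Lemma edge_set_lt e i j : val e = (i, j) -> edge_set i j = [set e].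
Proof.
move=> h; apply/setP => e'; rewrite !inE -h val_eqE.
case: eqP => //= ne; apply/negP => /eqP h'.
have := valP e; have := valP e'; rewrite /= h h' /=.
by move=> h1 h2; have := ltn_trans h1 h2; rewrite ltnn.
Qed.

Lemma edge_set_neq i j : i != j -> exists e, edge_set i j = [set e].
Proof.
wlog ij : i j / (i < j)%N => [hw|_].
  move=> ne; case: (ltngtP i j) => [ij|ji|/val_inj eij].
  - exact: hw.
  - by have [e he] := hw _ _ ji (negbT (ltn_eqF ji)); exists e; rewrite edge_setC.
  - by rewrite eij eqxx in ne.
by exists (exist _ (i, j) ij); apply: edge_set_lt.
Qed.

Lemma card_edge_set i j : i != j -> #|edge_set i j| = 1%N.
Proof. by move/edge_set_neq => [e ->]; rewrite cards1. Qed.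

Definition edges s : {set upair n} := \bigcup_(x <- s) edge_set x.1 x.2.

Lemma edges_cons x s : edges (x :: s) = edge_set x.1 x.2 :|: edges s.
Proof. by rewrite /edges big_cons. Qed.

Lemma edges_endpoints r k s e : s \in trees r k -> e \in edges s ->
  ((val e).1 \in verts r s) && ((val e).2 \in verts r s).
Proof.
move=> st; rewrite /edges finset.bigcup_seq => /finset.bigcupP[x xs].
have /andP[h1 h2] := tree_endpoints st xs.
by rewrite inE => /orP[] /eqP -> /=; rewrite ?h1 ?h2.
Qed.

Lemma edge_set_disjoint r k s p c : s \in trees r k -> c \notin verts r s ->
  [disjoint edge_set p c & edges s].
Proof.
move=> st cv; apply/pred0P => e /=; apply/negP => /andP[].
rewrite inE => he /(edges_endpoints st)/andP[h1 h2].
by case/orP: he => /eqP he; move: h1 h2; rewrite he /= (negbTE cv) // andbF.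
Qed.

Lemma card_edges r k s : s \in trees r k -> #|edges s| = k.
Proof.
elim/trees_ind: k s / => [|k p c s st pv cv IH].
  by rewrite /edges big_nil cards0.
rewrite edges_cons cardsU disjoint_setI0 ?cards0 ?subn0; last first.
  exact: edge_set_disjoint st cv.
by rewrite IH card_edge_set //=; apply: contraNneq cv => <-.
Qed.

Lemma sum_edges (f : upair n -> nat) r k s : s \in trees r k ->
  (\sum_(e in edges s) f e = \sum_(x <- s) \sum_(e in edge_set x.1 x.2) f e)%N.
Proof.
elim/trees_ind: k s / => [|k p c s st pv cv IH].
  by rewrite /edges !big_nil big_set0.
rewrite edges_cons big_cons -IH (eq_bigl [predU edge_set p c & edges s]) => [|e]; last by rewrite !inE.
exact: bigU (edge_set_disjoint _ st cv).
Qed.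

(** Stars are trees, so that [card_edges] also counts the edges of a star. *)
Lemma star_tree i (l : seq 'I_n) : uniq l -> i \notin l ->
  [seq (i, j) | j <- l] \in trees i (size l).
Proof.
elim: l => [|j l IH] //= /andP[jl ul]; rewrite inE negb_or => /andP[ij il].
apply/trees_consP; split; first exact: IH.
  by rewrite inE eqxx.
by rewrite /verts -map_comp map_id inE negb_or eq_sym ij.
Qed.

End PairEdges.

(** * Probabilities of heavy edge sets and of large two-step degrees *)

Section LocalEvents.
Variables (R : realType) (n m N : nat) (q : 'I_m.+1 -> R).
Hypothesis q_ge0 : forall a, 0 <= q a.
Hypothesis q_sum1 : \sum_a q a = 1.
Local Notation conf := {ffun upair n -> 'I_m.+1}.
Local Notation pr := (pr q).
Local Notation expect := (expect q).
Implicit Types (f g : conf) (F : {set upair n}).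

(** The sum has one term if [i != j] and none if [i = j]: this is the symmetric
    matrix with zero diagonal whose upper part is [f]. *)
Definition state f (i j : 'I_n) : nat := (\sum_(e in edge_set i j) f e)%N.

Lemma state_sym f i j : state f i j = state f j i.
Proof. by rewrite /state edge_setC. Qed.

Lemma state_diag f i : state f i i = 0%N.
Proof. by rewrite /state edge_set_diag big_set0. Qed.

Lemma state_mono f g : (forall e, f e <= g e)%N -> forall i j, (state f i j <= state g i j)%N.
Proof. by move=> fg i j; apply: leq_sum. Qed.

Lemma state_edge f e i j : e \in edge_set i j -> state f i j = f e.
Proof.
move=> he; have [eij|ij] := eqVneq i j.
  by rewrite eij edge_set_diag inE in he.
have [e' h] := edge_set_neq ij; rewrite /state h big_set1.
by move: he; rewrite h inE => /eqP ->.
Qed.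

Variables (u sigma : R).
Hypotheses (u_ge0 : 0 <= u) (sigma_ge0 : 0 <= sigma).

Definition heavy_set F (t : R) f : bool :=
  [forall e in F, (N < f e)%N] && (t <= u * (\sum_(e in F) f e)%:R).

Lemma heavy_set_increasing F t : increasing_event (heavy_set F t).
Proof.
move=> f g fg /andP[/forall_inP Ff tf]; apply/andP; split.
  by apply/forall_inP => e eF; apply: leq_trans (fg e); exact: Ff.
by apply: le_trans tf _; rewrite ler_wpM2l // ler_nat leq_sum.
Qed.

(** Exponential moment of one edge, restricted to heavy states. *)
Definition heavy_mgf : R := \sum_a q a * ((N < a)%N%:R * expR (sigma * u * a%:R)).

Lemma heavy_mgf_ge0 : 0 <= heavy_mgf.
Proof. by apply: sumr_ge0 => a _; rewrite !mulr_ge0 ?expR_ge0. Qed.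

(** Exponential Markov inequality; independence factorizes the moment over the
    edges of [F]. *)
Lemma pr_heavy_set F t : pr (heavy_set F t) <= expR (- (sigma * t)) * heavy_mgf ^+ #|F|.
Proof.
pose phi e (a : 'I_m.+1) : R :=
  if e \in F then (N < a)%N%:R * expR (sigma * u * a%:R) else 1.
have -> : heavy_mgf ^+ #|F| = expect (fun f => \prod_e phi e (f e)).
  rewrite expect_prod -prodr_const big_mkcond /=; apply: eq_bigr => e _.
  rewrite /phi; case: ifP => // _.
  by under eq_bigr => a _ do rewrite mulr1.
rewrite -expectZ; apply: le_expect => // f.
case: (boolP (heavy_set F t f)) => [/andP[/forall_inP Ff tf]|_]; last first.
  rewrite mulr_ge0 ?expR_ge0 ?prodr_ge0 // => e _.
  by rewrite /phi; case: ifP => // _; rewrite mulr_ge0 ?expR_ge0.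
have -> : \prod_e phi e (f e) = expR (sigma * (u * (\sum_(e in F) f e)%:R)).
  rewrite natr_sum !mulr_sumr expR_sum [RHS]big_mkcond; apply: eq_bigr => e _.
  by rewrite /phi; case: ifP => // eF; rewrite Ff // mul1r mulrA.
rewrite -expRD; apply: (@le_trans _ _ (expR 0)); first by rewrite expR0.
by rewrite ler_expR addrC subr_ge0 ler_wpM2l.
Qed.

(** The number of walks of two steps from [i]. *)
Definition degree2 f (i : 'I_n) : R :=
  \sum_j \sum_k ((0 < state f i j)%N%:R * (0 < state f j k)%N%:R).

Lemma degree2_mono f g i : (forall e, f e <= g e)%N -> degree2 f i <= degree2 g i.
Proof.
move=> fg; apply: ler_sum => j _; apply: ler_sum => k _.
have le a b : ((0 < state f a b)%N%:R : R) <= (0 < state g a b)%N%:R.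
  rewrite ler_nat; have := state_mono fg a b.
  by case: (state f a b) => // ?; case: (state g a b).
by apply: ler_pM.
Qed.

Definition edge_prob : R := \sum_(a : 'I_m.+1 | (0 < a)%N) q a.

Lemma edge_prob_ge0 : 0 <= edge_prob.
Proof. exact: sumr_ge0. Qed.

(** The factors of the exponential moment of [degree2] only distinguish absent
    from present edges. *)
Lemma mean_edge_weight (c0 c1 : R) :
  \sum_a q a * (if (0 < a)%N then c1 else c0) = c0 + edge_prob * (c1 - c0).
Proof.
rewrite (bigID (fun a : 'I_m.+1 => (0 < a)%N)) /=.
rewrite (eq_bigr (fun a => q a * c1)) => [|a ->] //.
rewrite [X in _ + X](eq_bigr (fun a => q a * c0)) => [|a /negbTE ->] //.
rewrite -!mulr_suml.
move: q_sum1; rewrite (bigID (fun a : 'I_m.+1 => (0 < a)%N)) /= -/edge_prob.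
set p' := \sum_(a | ~~ _) _ => h; have -> : p' = 1 - edge_prob by rewrite -h; ring.
ring.
Qed.

Definition touch (S : {set 'I_n}) (e : upair n) : nat :=
  ((val e).1 \in S) + ((val e).2 \in S).

Lemma sum_degrees_le f (S : {set 'I_n}) :
  (\sum_(j in S) \sum_k (0 < state f j k) <= \sum_e touch S e * (0 < f e))%N.
Proof.
have sum1 (a : 'I_n) (D : {set 'I_n}) : (\sum_(k in D) (a == k) <= (a \in D))%N.
  have [aD|aD] := boolP (a \in D).
    by rewrite (bigD1 a) //= eqxx big1 // => k /andP[_]; rewrite eq_sym => /negbTE ->.
  by rewrite big1 // => k kD; case: eqP kD aD => // -> ->.
have sum2 (a b : 'I_n) (D D' : {set 'I_n}) :
    (\sum_(j in D) \sum_(k in D') ((a, b) == (j, k)) <= (a \in D))%N.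
  apply: leq_trans (sum1 a D); apply: leq_sum => j _.
  under eq_bigr => k _ do rewrite xpair_eqE -mulnb.
  rewrite -big_distrr /= -[leqRHS]muln1 leq_mul2l; apply/orP; right.
  by apply: leq_trans (sum1 b D') _; case: (_ \in _).
apply: (@leq_trans (\sum_(j in S) \sum_(k in [set: 'I_n]%SET)
    \sum_e ((val e == (j, k)) + (val e == (k, j))) * (0 < f e))%N).
  apply: leq_sum => j _; rewrite [leqRHS](eq_bigl predT) => [|k]; last by rewrite inE.
  apply: leq_sum => k _; case: posnP => //= st0.
  have jk : j != k by apply: contraTneq st0 => ->; rewrite state_diag.
  have [e he] := edge_set_neq jk.
  have ein : e \in edge_set j k by rewrite he inE.
  rewrite (bigD1 e) //= -(state_edge f ein) st0 muln1.
  by move: ein; rewrite inE => /orP[] ->; rewrite ?addn1 // addSn.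
under eq_bigr => j _ do rewrite exchange_big.
rewrite exchange_big /=; apply: leq_sum => e _.
under eq_bigr => j _ do rewrite -big_distrl /=.
rewrite -big_distrl /= leq_mul2r; apply/orP; right.
under eq_bigr => j _ do rewrite big_split /=.
rewrite big_split /= /touch; apply: leq_add.
  by have := sum2 (val e).1 (val e).2 S [set: 'I_n]%SET; rewrite -surjective_pairing.
have := sum2 (val e).2 (val e).1 S [set: 'I_n]%SET; apply: leq_trans.
apply: leq_sum => j _; apply: leq_sum => k _.
by case: (val e =P (k, j)) => // ->; rewrite /= !eqxx.
Qed.

Lemma sum_touch_le (S : {set 'I_n}) : (\sum_e touch S e <= 2 * (#|S| * n))%N.
Proof.
have le (h : 'I_n * 'I_n -> nat) : (\sum_(e : upair n) h (val e) <= \sum_x h x)%N.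
  have := big_imset (h := val) (A := [set: upair n]%SET) (idx:=0%N) (aop := addn) h (in2W val_inj).
  rewrite [X in _ = X](eq_bigl predT) => [<-|e]; last by rewrite inE.
  by rewrite [leqLHS]big_mkcond; apply: leq_sum => x _; case: ifP.
have cnt : (\sum_(i : 'I_n) (i \in S) = #|S|)%N.
  by rewrite -sum1_card [RHS]big_mkcond; apply: eq_bigr => i _; case: ifP.
rewrite /touch big_split /= mul2n -addnn; apply: leq_add.
  apply: leq_trans (le (fun x => (x.1 \in S) : nat)) _.
  rewrite -(pair_big predT predT (fun a b : 'I_n => (a \in S) : nat)) /=.
  under eq_bigr => a _ do rewrite sum_nat_const card_ord.
  by rewrite -big_distrr /= cnt mulnC.
apply: leq_trans (le (fun x => (x.2 \in S) : nat)) _.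
rewrite -(pair_big predT predT (fun a b : 'I_n => (b \in S) : nat)) /=.
by rewrite sum_nat_const card_ord cnt mulnC.
Qed.

(** [expR (n%:R * z)] with [z] the base of the power in [expect_star] below and
    [n%:R * edge_prob] replaced by its bound [d]. *)
Definition degree2_const (d : R) : R := expR (d * (expR 2 * expR (2 * d * (expR 2 - 1)))).

Definition star (i : 'I_n) (S : {set 'I_n}) := edges [seq (i, j) | j <- enum S].

(** An edge of the star contributes its probability and a bounded factor.  Any
    other edge meeting [S] contributes [1 + O(edge_prob)], and there are at most
    [2 * #|S| * n] of them, so that these factors multiply to [O(1) ^+ #|S|]. *)
Lemma expect_star i (S : {set 'I_n}) (d : R) : i \notin S -> edge_prob * n%:R <= d ->
  expect (fun f => [forall e in star i S, (0 < f e)%N]%:R *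
      expR (\sum_e touch S e * (0 < f e))%:R) <=
  (edge_prob * (expR 2 * expR (2 * d * (expR 2 - 1)))) ^+ #|S|.
Proof.
move=> iS pd.
have p0 := edge_prob_ge0.
have e2 : 0 <= expR 2 - 1 :> R by rewrite subr_ge0 -expR0 ler_expR.
(* The factor vanishes if an edge of the star is absent. *)
pose psi e (a : 'I_m.+1) : R := if (0 < a)%N then expR (touch S e)%:R
  else if e \in star i S then 0 else 1.
have cardstar : #|star i S| = #|S|.
  by rewrite (card_edges (star_tree (enum_uniq S) _)) ?mem_enum // cardE.
apply: (@le_trans _ _ (expect (fun f => \prod_e psi e (f e)))).
  apply: le_expect => // f.
  have psi0 e : 0 <= psi e (f e).
    by rewrite /psi; do 2?case: ifP => // _; rewrite ?expR_ge0.
  case: (boolP [forall e in star i S, (0 < f e)%N]) => [/forall_inP h|_]; last first.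
    by rewrite mul0r prodr_ge0.
  rewrite mul1r natr_sum expR_sum; apply: ler_prod => e _; rewrite expR_ge0 /=.
  rewrite /psi natrM; case: posnP => [f0|_]; rewrite ?mulr1 // mulr0 expR0.
  by case: ifP => // /h; rewrite f0.
rewrite expect_prod.
under eq_bigr => e _ do rewrite mean_edge_weight.
apply: (@le_trans _ _ (\prod_e ((if e \in star i S then edge_prob * expR 2 else 1) *
    expR (edge_prob * (expR 2 - 1) * (touch S e)%:R)))).
  have t2 e : (touch S e <= 2)%N by rewrite /touch; do 2!case: (_ \in _).
  apply: ler_prod => e _; apply/andP; split.
    case: ifP => _; rewrite ?add0r ?subr0; first by rewrite mulr_ge0 ?expR_ge0.
    by rewrite addr_ge0 // mulr_ge0 // subr_ge0 -expR0 ler_expR.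
  case: ifP => _.
    rewrite add0r subr0 -mulrA ler_wpM2l //.
    apply: (@le_trans _ _ (expR 2)); first by rewrite ler_expR ler_nat.
    by rewrite ler_peMr ?expR_ge0 // -expR0 ler_expR !mulr_ge0.
  rewrite mul1r; apply: le_trans (expR_ge1Dx _) ; rewrite lerD2l -mulrA ler_wpM2l //.
  have e12 : expR 1 <= expR 2 :> R by rewrite ler_expR ler1n.
  move: (touch S e) (t2 e) => [|[|[|]]] //= _; rewrite ?expR0; lra.
rewrite big_split /= -big_mkcond prodr_const cardstar -expR_sum.
rewrite mulrA [leRHS]exprMn; apply: ler_wpM2l.
  by rewrite exprn_ge0 // mulr_ge0 ?expR_ge0.
rewrite -mulr_sumr -natr_sum -expRM_natr ler_expR.
apply: (@le_trans _ _ (edge_prob * (expR 2 - 1) * (2 * (#|S| * n))%:R)).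
  by rewrite ler_wpM2l ?mulr_ge0 // ler_nat sum_touch_le.
rewrite !natrM.
have -> : edge_prob * (expR 2 - 1) * (2%:R * (#|S|%:R * n%:R)) =
  (edge_prob * n%:R) * (2 * (expR 2 - 1) * #|S|%:R) by ring.
have -> : 2 * d * (expR 2 - 1) * #|S|%:R = d * (2 * (expR 2 - 1) * #|S|%:R) by ring.
by rewrite ler_wpM2r // !mulr_ge0.
Qed.

(** Chernoff bound at parameter 1.  The value of [expR (degree2 f i)] is bounded
    by the sum, over all vertex sets [S] avoiding [i], of the terms of
    [expect_star], since the neighbourhood of [i] is one of these sets; and the sum
    of [z ^+ #|S|] over [S] is at most [expR (n%:R * z)] with [n%:R * z] bounded. *)
Lemma pr_degree2 i d L : edge_prob * n%:R <= d ->
  pr (fun f => L < degree2 f i) <= degree2_const d * expR (- L).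
Proof.
move=> pd; have p0 := edge_prob_ge0.
pose T f (S : {set 'I_n}) : R := [forall e in star i S, (0 < f e)%N]%:R *
      expR (\sum_e touch S e * (0 < f e))%:R.
apply: (@le_trans _ _ (expR (- L) * expect (fun f => \sum_(S : {set 'I_n} | i \notin S) T f S))).
  rewrite -expectZ; apply: le_expect => // f.
  have T0 S : 0 <= T f S by rewrite mulr_ge0 ?expR_ge0.
  case: ltP => [Lf|_] /=; last by rewrite mulr_ge0 ?expR_ge0 ?sumr_ge0.
  pose S := [set j | (0 < state f i j)%N]%SET.
  rewrite mulrC expRN ler_pdivlMr ?expR_gt0 // mul1r (bigD1 S) /=; last first.
    by rewrite inE state_diag.
  apply: ler_wpDr; first exact: sumr_ge0.
  rewrite /T; have -> : [forall e in star i S, (0 < f e)%N].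
    apply/forall_inP => e; rewrite /star /edges finset.bigcup_seq => /finset.bigcupP[x].
    by case/mapP => j; rewrite mem_enum inE => ij -> /= /(state_edge f) <-.
  rewrite mul1r ler_expR; apply: (le_trans (ltW Lf)).
  apply: le_trans (_ : (\sum_(j in S) \sum_k (0 < state f j k))%N%:R <= _); last first.
    by rewrite ler_nat sum_degrees_le.
  rewrite /degree2 natr_sum [leRHS]big_mkcond; apply: ler_sum => j _.
  rewrite inE; case: posnP => _ /=.
    by rewrite big1 // => k _; rewrite mul0r.
  by rewrite natr_sum; apply: ler_sum => k _; rewrite mul1r.
rewrite mulrC ler_wpM2r ?expR_ge0 // expect_sum.
set z := edge_prob * (expR 2 * expR (2 * d * (expR 2 - 1))).
have z0 : 0 <= z by rewrite !mulr_ge0 ?expR_ge0.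
apply: (@le_trans _ _ (\sum_(S : {set 'I_n}) z ^+ #|S|)).
  rewrite big_mkcond; apply: ler_sum => S _; case: ifP => iS; last exact: exprn_ge0.
  exact: expect_star.
have -> : \sum_(S : {set 'I_n}) z ^+ #|S| = (z + 1) ^+ n.
  rewrite -[in RHS](card_ord n) -prodr_const.
  have := bigA_distr 1 +%R (fun _ : 'I_n => z) (fun=> 1).
  move=> /= h; rewrite (eq_bigl predT) // h; apply: eq_big => S; rewrite ?inE // => _.
  by rewrite -big_mkcond prodr_const.
apply: (@le_trans _ _ (expR z ^+ n)).
  by rewrite lerXn2r ?nnegrE ?addr_ge0 ?expR_ge0 // addrC expR_ge1Dx.
rewrite -expRM_natr ler_expR /z mulrAC ler_wpM2r //.
Qed.

End LocalEvents.

(** * The union bound over bad events *)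

(** For [0 <= x <= 1 / 2] one has [(1 - x) * (1 + 2 * x) >= 1]. *)
Lemma expR_le_prod_onem (R : realType) (I : eqType) (r : seq I) (x : I -> R) :
    (forall i, i \in r -> 0 <= x i <= 1 / 2) ->
  expR (- (2 * \sum_(i <- r) x i)) <= \prod_(i <- r) (1 - x i).
Proof.
move=> hx; rewrite mulr_sumr -sumrN expR_sum big_seq [leRHS]big_seq.
apply: ler_prod => i /hx /andP[x0 x2]; rewrite expR_ge0 /= expRN.
rewrite -[leLHS]mul1r ler_pdivrMr ?expR_gt0 //.
apply: (@le_trans _ _ ((1 - x i) * (1 + 2 * x i))); first by nra.
by apply: ler_wpM2l; [lra|exact: expR_ge1Dx].
Qed.

Lemma sum_halves (R : realType) k : \sum_(i <- iota 0 k) (1 / 2 : R) ^+ i = 2 - 2 * (1 / 2) ^+ k.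
Proof.
elim: k => [|k IH]; first by rewrite big_nil expr0; ring.
by rewrite -addn1 iotaD big_cat IH /= big_seq1 add0n exprD expr1; field.
Qed.

Lemma edge_set_extra_disjoint n (s : seq ('I_n * 'I_n)) a b :
  (a, b) \notin s -> (b, a) \notin s -> [disjoint edge_set a b & edges s].
Proof.
move=> abs bas; apply/pred0P => e /=; apply/negP => /andP[].
rewrite inE /edges finset.bigcup_seq => he /finset.bigcupP[[c d] xs].
rewrite inE /= => he'.
case/orP: he => /eqP he; move: he'; rewrite he !xpair_eqE => /orP[] /andP[/eqP e1 /eqP e2];
  by move: xs; rewrite -e1 -e2 ?(negbTE abs) ?(negbTE bas).
Qed.

Section UnionBound.
Variables (R : realType) (n m N : nat) (q : 'I_m.+1 -> R).
Hypothesis q_ge0 : forall a, 0 <= q a.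
Hypothesis q_sum1 : \sum_a q a = 1.
Local Notation conf := {ffun upair n -> 'I_m.+1}.
Local Notation pr := (pr q).
Variables (u sigma tau L d : R).
Hypotheses (u_gt0 : 0 < u) (sigma_ge0 : 0 <= sigma) (tau_gt0 : 0 < tau).
Hypothesis edge_prob_le : edge_prob q * n%:R <= d.
Local Notation b := (heavy_mgf N q u sigma).
Hypothesis mgf_small : n%:R * m%:R ^+ 2 * b <= 1 / 2.
Hypothesis degree_small : degree2_const d * expR (- L) <= 1 / 2.
Hypothesis m_gt0 : (0 < m)%N.

Local Notation event := ({set upair n} * R)%type.

Definition tree_events k r : seq event := [seq (edges s, tau) | s <- trees r k].

Definition extra (s : seq ('I_n * 'I_n)) (x : 'I_n * 'I_n) :=
  [&& x.1 != x.2, x \notin s & (x.2, x.1) \notin s].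

(** A tree together with one more edge between two of its vertices, that is, a
    connected graph with a cycle.  The bound 0 on the weight imposes only that all
    edges are heavy. *)
Definition cycle_events k r : seq event :=
  [seq (edges s :|: edge_set x.1 x.2, 0) | s <- trees r k,
     x <- [seq x <- [seq (a, a') | a <- verts r s, a' <- verts r s] | extra s x]].

Definition over_roots (ev : nat -> 'I_n -> seq event) ks : seq event :=
  flatten [seq flatten [seq ev k r | r <- enum 'I_n] | k <- ks].

Definition bad_events : seq (event + 'I_n) :=
  [seq inl x | x <- over_roots tree_events (iota 1 m)] ++
  [seq inl x | x <- over_roots cycle_events (iota 0 m)] ++ [seq inr i | i <- enum 'I_n].

Definition bad (x : event + 'I_n) : pred conf := fun f =>
  match x with inl Ft => heavy_set N u Ft.1 Ft.2 f | inr i => L < degree2 R f i end.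

Definition good f := all (fun x => ~~ bad x f) bad_events.

Lemma bad_increasing x : increasing_event (bad x).
Proof.
case: x => [[F t]|i] /=; first by apply: heavy_set_increasing; exact: ltW.
by move=> f g fg; move/lt_le_trans; apply; exact: degree2_mono.
Qed.

Let b0 : 0 <= b. Proof. exact: heavy_mgf_ge0. Qed.

(* The argument only witnesses that there is a vertex. *)
Let mgf_le (r : 'I_n) : b <= 1 / 2.
Proof.
apply: le_trans mgf_small; rewrite ler_peMl // -natrX -natrM ler1n muln_gt0 expn_gt0 m_gt0.
by rewrite (leq_ltn_trans _ (ltn_ord r)).
Qed.

Let mnb_le (r : 'I_n) : (m * n)%:R * b <= 1 / 2.
Proof.
apply: le_trans mgf_small; rewrite ler_wpM2r // natrM mulrC ler_wpM2l //.
by rewrite expr2 ler_peMl // ler1n.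
Qed.

Lemma over_rootsP ev ks x : x \in over_roots ev ks ->
  exists k r, k \in ks /\ x \in ev k r.
Proof.
move/flatten_mapP => [k kks /flatten_mapP[r _ xr]]; by exists k, r.
Qed.

Lemma tree_event_le k r x : x \in tree_events k r ->
  pr (bad (inl x)) <= expR (- (sigma * tau)) * b ^+ k.
Proof.
by move=> /mapP[s st ->]; rewrite -(card_edges st) /=; apply: pr_heavy_set.
Qed.

Lemma cycle_event_le k r x : x \in cycle_events k r -> pr (bad (inl x)) <= b ^+ k.+1.
Proof.
move=> /allpairsPdep[s [[a a'] [st]]]; rewrite mem_filter => /andP[/and3P[/= aa abs bas] _] ->.
apply: (@le_trans _ _ (expR (- (sigma * 0)) * b ^+ #|edges s :|: edge_set a a'|)).
  by apply: pr_heavy_set => //; exact: ltW.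
rewrite mulr0 oppr0 expR0 mul1r /= finset.setUC cardsU disjoint_setI0 ?cards0 ?subn0.
  by rewrite card_edge_set // (card_edges st).
exact: edge_set_extra_disjoint.
Qed.

Lemma sum_over_roots ev ks (c : R) (G : event -> R) :
    (forall k r, k \in ks -> \sum_(x <- ev k r) G x <= c * (1 / 2) ^+ k) ->
  \sum_(x <- over_roots ev ks) G x <= n%:R * (c * \sum_(k <- ks) (1 / 2) ^+ k).
Proof.
move=> H; rewrite big_flatten big_map !mulr_sumr big_seq [leRHS]big_seq.
apply: ler_sum => k kks; rewrite big_flatten big_map /=.
apply: (@le_trans _ _ (\sum_(r <- enum 'I_n) c * (1 / 2) ^+ k)).
  by apply: ler_sum => r _; exact: H.
by rewrite big_const_seq count_predT iter_addr_0 size_enum_ord mulr_natl.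
Qed.

(** The factor [1 / 2] gained at each step of the growth makes the sum over the
    sizes of the trees converge. *)
Lemma size_trees_mgf k (r : 'I_n) : (k <= m)%N -> (size (trees r k))%:R * b ^+ k <= (1 / 2) ^+ k.
Proof.
move=> km; apply: le_trans (_ : ((m * n)%:R * b) ^+ k <= _); last first.
  by rewrite lerXn2r ?nnegrE ?mulr_ge0 // mnb_le.
rewrite exprMn ler_wpM2r ?exprn_ge0 // -natrX ler_nat.
apply: leq_trans (size_trees_le _ _) _; rewrite card_ord.
by case: k km => // k km; rewrite leq_exp2r // leq_mul2r km orbT.
Qed.

Lemma sum_tree_events k r : k \in iota 1 m ->
  \sum_(x <- tree_events k r) pr (bad (inl x)) <= expR (- (sigma * tau)) * (1 / 2) ^+ k.
Proof.
rewrite mem_iota add1n ltnS => km.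
apply: (@le_trans _ _ (\sum_(x <- tree_events k r) expR (- (sigma * tau)) * b ^+ k)).
  by rewrite big_seq [leRHS]big_seq; apply: ler_sum => x; exact: tree_event_le.
rewrite big_const_seq count_predT iter_addr_0 size_map -[leLHS]mulr_natl mulrCA ler_wpM2l ?expR_ge0 //.
by apply: size_trees_mgf; case/andP: km.
Qed.

Lemma size_cycle_events k r : (k < m)%N ->
  (size (cycle_events k r) <= size (trees r k) * m ^ 2)%N.
Proof.
move=> km; rewrite size_allpairs_dep sumnE big_map.
apply: (@leq_trans (\sum_(s <- trees r k) m ^ 2)%N); last first.
  by rewrite big_const_seq count_predT iter_addn_0 mulnC.
rewrite big_seq [leqRHS]big_seq; apply: leq_sum => s st.
rewrite size_filter (leq_trans (count_size _ _)) // size_allpairs /verts /= size_map.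
by rewrite (size_trees_mem st) leq_mul.
Qed.

Lemma sum_cycle_events k r : k \in iota 0 m ->
  \sum_(x <- cycle_events k r) pr (bad (inl x)) <= m%:R ^+ 2 * b * (1 / 2) ^+ k.
Proof.
rewrite mem_iota add0n /= => km.
apply: (@le_trans _ _ (\sum_(x <- cycle_events k r) b ^+ k.+1)).
  by rewrite big_seq [leRHS]big_seq; apply: ler_sum => x; exact: cycle_event_le.
rewrite big_const_seq count_predT iter_addr_0 -[leLHS]mulr_natl.
apply: (@le_trans _ _ ((size (trees r k) * m ^ 2)%:R * b ^+ k.+1)).
  by rewrite ler_wpM2r ?exprn_ge0 // ler_nat size_cycle_events.
rewrite natrM natrX (exprS b k).
have -> : (size (trees r k))%:R * m%:R ^+ 2 * (b * b ^+ k) =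
  m%:R ^+ 2 * b * ((size (trees r k))%:R * b ^+ k) by ring.
by rewrite ler_wpM2l ?mulr_ge0 ?exprn_ge0 // size_trees_mgf // ltnW.
Qed.

(** The three terms come from the heavy trees reaching [tau], from the trees with
    an additional edge, where the additional factor [n%:R * m%:R ^+ 2 * b] makes the
    sum over all roots bounded, and from the two-step degrees. *)
Lemma sum_bad_le : \sum_(x <- bad_events) pr (bad x) <=
  n%:R * expR (- (sigma * tau)) + 1 + n%:R * (degree2_const d * expR (- L)).
Proof.
rewrite !big_cat !big_map /= addrA; apply: lerD; first apply: lerD.
- apply: le_trans (sum_over_roots sum_tree_events) _.
  rewrite ler_wpM2l // ler_piMr ?expR_ge0 //.
  have := sum_halves R m.+1; rewrite /= big_cons expr0 exprS => h.
  have : 0 <= (1 / 2 : R) ^+ m by rewrite exprn_ge0.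
  lra.
- apply: le_trans (sum_over_roots sum_cycle_events) _.
  have t0 : 0 <= n%:R * m%:R ^+ 2 * b by rewrite !mulr_ge0 ?exprn_ge0.
  have h0 : 0 <= (1 / 2 : R) ^+ m by rewrite exprn_ge0.
  rewrite sum_halves; have := mulr_ge0 t0 h0; have := mgf_small; lra.
- apply: (@le_trans _ _ (\sum_(i <- enum 'I_n) degree2_const d * expR (- L))).
    by rewrite [leRHS]big_map; apply: ler_sum => i _; exact: pr_degree2.
  by rewrite big_const_seq count_predT iter_addr_0 size_enum_ord mulr_natl.
Qed.

Lemma bad_le_half x : x \in bad_events -> 0 <= pr (bad x) <= 1 / 2.
Proof.
move=> xin; rewrite pr_ge0 //=.
have pow_le k (r : 'I_n) : b ^+ k.+1 <= 1 / 2.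
  apply: le_trans (mgf_le r); rewrite exprS ler_piMr // exprn_ile1 //.
  by apply: le_trans (mgf_le r) _; lra.
move: xin; rewrite !mem_cat => /or3P[] /mapP[y yin ->].
- have [k [r [kin yk]]] := over_rootsP yin.
  move: kin; rewrite mem_iota add1n ltnS => km.
  apply: le_trans (tree_event_le yk) _.
  case: k km {yk} => // k km; apply: le_trans (pow_le k r).
  rewrite ler_piMl ?exprn_ge0 // -expR0 ler_expR oppr_le0 mulr_ge0 // ltW //.
- have [k [r [kin yk]]] := over_rootsP yin.
  exact: le_trans (cycle_event_le yk) (pow_le k r).
- by apply: le_trans degree_small; exact: pr_degree2.
Qed.

Lemma pr_good_ge : expR (- (2 * (n%:R * expR (- (sigma * tau)) + 1 +
    n%:R * (degree2_const d * expR (- L))))) <= pr good.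
Proof.
apply: (@le_trans _ _ (expR (- (2 * \sum_(x <- bad_events) pr (bad x))))).
  by rewrite ler_expR lerN2 ler_pM2l // sum_bad_le.
apply: le_trans (expR_le_prod_onem bad_le_half) _.
by apply: pr_avoid_ge => //; exact: bad_increasing.
Qed.

Lemma heavy_edges (f : conf) s e : heavy (heavy_edge (state f) N) s -> e \in edges s -> (N < f e)%N.
Proof.
move=> /allP hs; rewrite /edges finset.bigcup_seq => /finset.bigcupP[x xs ex].
by have := hs x xs; rewrite /heavy_edge (state_edge f ex).
Qed.

Lemma good_light_trees f : good f -> forall (r : 'I_n) k s, (k <= m)%N -> s \in trees r k ->
  heavy (heavy_edge (state f) N) s -> u * (\sum_(x <- s) state f x.1 x.2)%:R < tau.
Proof.
move=> /allP gf r [|k] s km st hs.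
  by move: st; rewrite inE => /eqP ->; rewrite big_nil mulr0.
have /gf : inl (edges s, tau) \in bad_events.
  rewrite !mem_cat; apply/orP; left; apply: map_f.
  apply/flatten_mapP; exists k.+1; first by rewrite mem_iota add1n ltnS.
  apply/flatten_mapP; exists r; first by rewrite mem_enum.
  exact: map_f.
rewrite /= /heavy_set => /nandP[/negP[]|].
  by apply/forall_inP => e; exact: heavy_edges.
by rewrite -ltNge (sum_edges _ st).
Qed.

Lemma good_no_cycle f : good f -> forall (r : 'I_n) k s, (k < m)%N -> s \in trees r k ->
  heavy (heavy_edge (state f) N) s -> forall i j, i \in verts r s -> j \in verts r s ->
  heavy_edge (state f) N i j -> (i, j) \in s \/ (j, i) \in s.
Proof.
move=> /allP gf r k s km st hs i j iv jv ij.
have [?|ijs] := boolP ((i, j) \in s); first by left.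
have [?|jis] := boolP ((j, i) \in s); first by right.
have nij : i != j by apply: contraTneq ij => ->; rewrite /heavy_edge state_diag.
have /gf : inl (edges s :|: edge_set i j, 0) \in bad_events.
  rewrite !mem_cat; apply/orP; right; apply/orP; left; apply: map_f.
  apply/flatten_mapP; exists k; first by rewrite mem_iota.
  apply/flatten_mapP; exists r; first by rewrite mem_enum.
  apply/allpairsPdep; exists s, (i, j); split=> //.
  rewrite mem_filter; apply/andP; split; first by rewrite /extra /= nij ijs.
  by apply/allpairsP; exists (i, j).
rewrite /= /heavy_set => /nandP[/negP[]|]; last first.
  by rewrite mulr_ge0 // ltW.
apply/forall_inP => e; rewrite finset.in_setU => /orP[|eij]; first exact: heavy_edges.
by rewrite -(state_edge f eij).
Qed.

Lemma good_degree f : good f -> forall i,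
  \sum_j \sum_k ((0 < state f i j)%N%:R * (0 < state f j k)%N%:R) <= L.
Proof.
move=> /allP gf i; have /gf : inr i \in bad_events.
  by rewrite !mem_cat; apply/orP; right; apply/orP; right; rewrite map_f ?mem_enum.
by rewrite /= -leNgt.
Qed.

End UnionBound.

Local Open Scope classical_set_scope.
Local Open Scope ring_scope.

(** * The law of the discretized edges *)

Lemma prob_finite_partition (R : realType) d (T : measurableType d) (P : probability T R)
    (I : finType) (F : T -> I) (A : pred I) : (forall i, measurable [set w | F w = i]) ->
  measurable [set w | A (F w)] /\
  P [set w | A (F w)] = (\sum_(i | A i) P [set w | F w = i])%E.
Proof.
move=> mF.
have -> : [set w | A (F w)] = \bigcup_(i in [set` A]) [set w | F w = i].
  apply/seteqP; split => [w /= Aw|w [f /= Af Fw]]; last by rewrite Fw.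
  by exists (F w).
split; first exact: fin_bigcup_measurable.
rewrite measure_fin_bigcup //; last by move=> f g _ _ [w [/= <- <-]].
by rewrite -(bigfs _ (r := index_enum I)) ?index_enum_uniq // => i _; rewrite mem_index_enum.
Qed.

Section StateLaw.
Variables (R : realType) (dO : measure_display) (O : measurableType dO).
Variables (Q : probability O R) (W : {RV Q >-> R}).
Variables (dT : measure_display) (T : measurableType dT) (P : probability T R).
Variables (n : nat) (X Y : 'I_n -> 'I_n -> {RV P >-> R}) (p : R).
Hypothesis hX : erdos_renyi_adjacency X p.
Hypothesis hY : iid_symmetric W Y.
Hypothesis hXY : independent_matrices X Y.
Variables (m : nat) (kappa : R -> 'I_m).
Hypothesis measurable_fiber : forall k, measurable [set y | kappa y = k].

(** Presence and level are merged into one state, with absence at the bottom, so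
    that the bad events are increasing in a single variable per edge. *)
Definition edge_states (w : T) : {ffun upair n -> 'I_m.+1} :=
  [ffun e => if upper X e w == 0 then ord0 else lift ord0 (kappa (upper Y e w))].

Definition state_law (a : 'I_m.+1) : R :=
  if unlift ord0 a is Some k then p * fine (Q [set z | kappa (W z) = k]) else 1 - p.

Let Xset (a : 'I_m.+1) : set R := if unlift ord0 a is Some _ then [set 1] else [set 0].
Let Yset (a : 'I_m.+1) : set R :=
  if unlift ord0 a is Some k then [set y | kappa y = k] else setT.

Let measurable_Xset a : measurable (Xset a).
Proof. by rewrite /Xset; case: unlift => [?|]; exact: measurable_set1. Qed.

Let measurable_Yset a : measurable (Yset a).
Proof. by rewrite /Yset; case: unlift => [?|]; [exact: measurable_fiber|exact: measurableT]. Qed.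

Let prob_Xset e a : P (upper X e @^-1` Xset a) =
  (if unlift ord0 a is Some _ then p else 1 - p)%:E.
Proof.
have [X01 _ _ Xp _] := hX.
rewrite /Xset; case: unlift => [?|]; first exact: Xp.
have -> : upper X e @^-1` [set 0] = ~` (upper X e @^-1` [set 1]).
  apply/seteqP; split => w /=; first by move=> ->; apply/eqP; rewrite eq_sym oner_eq0.
  by have [] := X01 w (val e).1 (val e).2.
rewrite probability_setC; last exact: measurable_funPTI.
by rewrite EFinB; congr (_ - _)%E; exact: Xp.
Qed.

Let prob_Yset e a : P (upper Y e @^-1` Yset a) =
  (if unlift ord0 a is Some k then fine (Q [set z | kappa (W z) = k]) else 1)%:E.
Proof.
have [_ _ law _] := hY.
have := law e _ (measurable_Yset a); rewrite /distribution /pushforward => ->.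
rewrite /Yset; case: unlift => [k|]; last by rewrite preimage_setT probability_setT.
rewrite fineK // fin_num_measure //; exact: (measurable_funPTI W (measurable_fiber k)).
Qed.

Lemma sigma_entries_bigcap (Z : 'I_n -> 'I_n -> {RV P >-> R}) (B : upair n -> set R) :
  (forall e, measurable (B e)) ->
  sigma_entries Z (\bigcap_(e in [set` [set: upair n]%SET]) (upper Z e @^-1` B e)).
Proof.
move=> mB; rewrite /sigma_entries; set G := [set _ | _].
apply: (@fin_bigcap_measurable _ (g_sigma_algebraType G)) => // e _.
by apply: sub_sigma_algebra; exists (val e).1, (val e).2, (B e).
Qed.

Let fiberE f : [set w | edge_states w = f] =
  (\bigcap_(e in [set` [set: upair n]%SET]) (upper X e @^-1` Xset (f e))) `&`
  (\bigcap_(e in [set` [set: upair n]%SET]) (upper Y e @^-1` Yset (f e))).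
Proof.
have [X01 _ _ _ _] := hX.
apply/seteqP; split => [w /= <-|w /= [hx hy]].
  split=> e _; rewrite /= /Xset /Yset ffunE.
    case: eqP => [->|]; first by rewrite unlift_none.
    rewrite liftK /=; by have [->|] := X01 w (val e).1 (val e).2.
  by case: eqP => _; rewrite ?unlift_none ?liftK.
apply/ffunP => e; rewrite ffunE.
have ein : [set` [set: upair n]%SET] e by rewrite /= inE.
move: (hx e ein) (hy e ein); rewrite /= /Xset /Yset.
case: unliftP => [k ->|->] /= -> //; last by rewrite eqxx.
by move=> ->; rewrite oner_eq0.
Qed.

(** Independence of the two matrices separates the presence of the edges from
    their levels, and independence of the entries gives a product over the edges. *)
Lemma prob_edge_states f : P [set w | edge_states w = f] = (pmass state_law f)%:E.
Proof.
have [_ _ _ _ indX] := hX; have [_ _ _ indY] := hY.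
rewrite fiberE hXY; try by apply: sigma_entries_bigcap.
rewrite indX // indY //.
under eq_bigr => e _ do rewrite prob_Xset.
under [X in (_ * X)%E]eq_bigr => e _ do rewrite prob_Yset.
rewrite !prodEFin -EFinM -big_split /=; congr EFin.
rewrite (eq_bigl predT) => [|e]; last by rewrite inE.
apply: eq_bigr => e _; rewrite /state_law; case: unlift => [k|] //.
by rewrite mulr1.
Qed.

Lemma measurable_edge_states f : measurable [set w | edge_states w = f].
Proof.
rewrite fiberE; apply: measurableI; apply: fin_bigcap_measurable => // e _;
  exact: measurable_funPTI.
Qed.

Lemma edge_states_event (A : pred {ffun upair n -> 'I_m.+1}) :
  measurable [set w | A (edge_states w)] /\
  P [set w | A (edge_states w)] = (pr state_law A)%:E.
Proof.
have [mA ->] := prob_finite_partition P A measurable_edge_states; split=> //.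
under eq_bigr => f _ do rewrite prob_edge_states.
rewrite sumEFin; congr EFin; rewrite big_mkcond; apply: eq_bigr => f _.
by case: ifP; rewrite ?mulr1 ?mulr0.
Qed.

Lemma state_law_ge0 a : 0 <= p <= 1 -> 0 <= state_law a.
Proof.
move=> /andP[p0 p1]; rewrite /state_law; case: unlift => [k|]; last by rewrite subr_ge0.
by rewrite mulr_ge0 // fine_ge0.
Qed.

Lemma sum_state_law : \sum_a state_law a = 1.
Proof.
rewrite big_ord_recl {1}/state_law unlift_none.
under eq_bigr => k _ do rewrite /state_law liftK.
have mk k : measurable [set z | kappa (W z) = k].
  exact: (measurable_funPTI W (measurable_fiber k)).
rewrite -mulr_sumr; suff -> : \sum_k fine (Q [set z | kappa (W z) = k]) = 1.
  by rewrite mulr1 subrK.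
have [_ h] := prob_finite_partition Q predT mk.
apply: EFin_inj; rewrite -sumEFin.
under eq_bigr => k _ do rewrite fineK ?fin_num_measure //.
by rewrite -h (_ : [set w | _] = setT) ?probability_setT //; apply/seteqP.
Qed.

End StateLaw.

(** * Measurability, and the upper bound on the probability *)

Lemma card_upair n : #|{: upair n}| = 'C(n, 2).
Proof.
rewrite -(triangular_sum n) big_mkord card_sig -sum1_card big_mkcond /=.
rewrite -(pair_big predT predT (fun a b : 'I_n => if (a < b)%N then 1%N else 0%N)) /=.
rewrite exchange_big /=; apply: eq_bigr => j _.
rewrite -big_mkcond /= -(big_ord_widen n (fun=> 1%N)) ?sum1_card ?card_ord //.
exact: ltnW.
Qed.

Section RandomMatrixEvents.
Variables (R : realType) (dO : measure_display) (O : measurableType dO).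
Variables (Q : probability O R) (W : {RV Q >-> R}).
Variables (dT : measure_display) (T : measurableType dT) (P : probability T R).
Variables (n : nat) (X Y : 'I_n -> 'I_n -> {RV P >-> R}) (p : R).
Hypothesis hX : erdos_renyi_adjacency X p.
Hypothesis hY : iid_symmetric W Y.
Hypothesis hXY : independent_matrices X Y.
Local Notation Z := (entrywise_product X Y).

Lemma entrywise_product_sym w : (Z w)^T = Z w.
Proof.
have [_ _ sX _ _] := hX; have [_ sY _ _] := hY.
by apply/matrixP => i j; rewrite !mxE sX sY.
Qed.

Lemma entrywise_product_diag w i : Z w i i = 0.
Proof. by have [_ dX _ _ _] := hX; rewrite mxE dX mul0r. Qed.

Lemma measurable_qform z (c : R) : measurable [set w | qform (Z w) z <= c].
Proof.
pose h (w : T) := \sum_i \sum_j X i j w * Y i j w * (z 0 i * z 0 j).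
have mh : measurable_fun setT h.
  apply: measurable_sum => i; apply: measurable_sum => j.
  by apply: measurable_funM => //; apply: measurable_funM.
have := mh measurableT _ (measurable_itv `]-oo, c]); rewrite setTI.
have E w : qform (Z w) z = h w.
  by rewrite /qform bformE; apply: eq_bigr => i _; apply: eq_bigr => j _; rewrite mxE.
by congr measurable; apply/seteqP; split=> w; rewrite /= in_itv /= E.
Qed.

Lemma measurable_lambda1_le t : 0 <= t -> measurable [set w | lambda1 (Z w) <= t].
Proof.
move=> t0.
pose E k := if unpickle k is Some z then
  [set w | qform (Z w) (map_mx intr (z : 'rV[int]_n)) <= t * sqnorm (map_mx intr z)] else setT.
have -> : [set w | lambda1 (Z w) <= t] = \bigcap_k E k.
  apply/seteqP; split=> w /=.
    move/(lambda1_le_intP (entrywise_product_sym w) t0) => H k _.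
    by rewrite /E; case: unpickle => //=.
  move=> H; apply/(lambda1_le_intP (entrywise_product_sym w) t0) => z.
  by have := H (pickle z) I; rewrite /E pickleK.
apply: bigcapT_measurable => k; rewrite /E.
by case: unpickle => [z|]; [exact: measurable_qform|exact: measurableT].
Qed.

Section UpperBound.
Variables (t s : R).
Hypotheses (t_ge0 : 0 <= t) (ts : t < s).

Definition exceeds (y : R) : 'I_2 := if s <= y then ord_max else ord0.

Lemma measurable_exceeds k : measurable [set y | exceeds y = k].
Proof.
have [->|->] : k = ord0 \/ k = ord_max.
  by case: k => [[|[|k]] hk] //; [left|right]; exact: val_inj.
- have := measurable_itv `]-oo, s[ : measurable (_ : set R); congr measurable.
  apply/seteqP; split => y; rewrite /= in_itv /= /exceeds; case: leP => //.
- have := measurable_itv `[s, +oo[ : measurable (_ : set R); congr measurable.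
  apply/seteqP; split => y; rewrite /= in_itv /= andbT /exceeds; case: leP => //.
Qed.

(** On this event no edge carries an entry above [s], and the edges are
    independent. *)
Lemma prob_lambda1_le_exp : 0 <= p <= 1 ->
  fine (P [set w | lambda1 (Z w) <= t]) <=
  expR (- (p * fine (Q [set z | s <= W z]) * #|{: upair n}|%:R)).
Proof.
move=> p01; have [X01 _ _ _ _] := hX.
pose A (f : {ffun upair n -> 'I_3}) := [forall e, f e != ord_max].
have [mA PA] := edge_states_event hX hY hXY measurable_exceeds A.
have sub : [set w | lambda1 (Z w) <= t] `<=` [set w | A (edge_states X Y exceeds w)].
  move=> w /= lt; apply/forallP => e; rewrite ffunE.
  case: (upper X e w =P 0) => // /eqP Xe; rewrite /exceeds; case: (leP s) => // sY.
  exfalso; have e12 : (val e).1 != (val e).2.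
    by apply/eqP => h; have := valP e; rewrite /= h ltnn.
  have := entry_le_lambda1 (entrywise_product_sym w) t_ge0 (entrywise_product_diag w) lt e12.
  rewrite mxE; have [X0|->] := X01 w (val e).1 (val e).2.
    by rewrite /upper X0 eqxx in Xe.
  by rewrite mul1r leNgt (lt_le_trans ts).
have q0 a := state_law_ge0 W exceeds a p01.
have q1 := sum_state_law W p measurable_exceeds.
apply: (@le_trans _ _ (fine (P [set w | A (edge_states X Y exceeds w)]))).
  have mt := measurable_lambda1_le t_ge0.
  by apply: fine_le; rewrite ?fin_num_measure //; apply: le_measure; rewrite ?inE.
rewrite PA /=; set q := state_law _ _ _ in q0 q1 *.
have qE : q (lift ord0 ord_max) = p * fine (Q [set z | s <= W z]).
  rewrite /q /state_law liftK; congr (_ * fine (Q _)).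
  by apply/seteqP; split=> z; rewrite /= /exceeds; case: leP.
have mx : lift ord0 ord_max = ord_max :> 'I_3 by exact: val_inj.
apply: (@le_trans _ _ (expect q (fun f : {ffun upair n -> 'I_3} =>
    \prod_e (f e != ord_max)%:R))).
  apply: le_expect => // f; case: (boolP (A f)) => [/forallP Af|_].
    by rewrite big1 // => e _; rewrite Af.
  by apply: prodr_ge0.
rewrite (expect_prod q (fun _ a => (a != ord_max)%:R)).
have -> : \sum_a q a * (a != ord_max)%:R = 1 - q ord_max.
  rewrite -[X in _ = X - _]q1 [in RHS](bigD1 ord_max) //= addrC addrK (bigD1 ord_max) //= ?eqxx mulr0 add0r.
  by apply: eq_bigr => a ->; exact: mulr1.
rewrite prodr_const -mx qE -[in leRHS]mulNr expRM_natr lerXn2r ?nnegrE ?expR_ge0 //.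
  rewrite -qE subr_ge0 mx -[leRHS]q1 (bigD1 ord_max) //= lerDl; exact: sumr_ge0.
by have := expR_ge1Dx (- (p * fine (Q [set z | s <= W z]))).
Qed.

End UpperBound.

End RandomMatrixEvents.

(** * The lower bound on the probability *)

Section Levels.
Variables (R : realType) (alpha u : R) (m' : nat).
Hypothesis u_gt0 : 0 < u.

(** The cap makes the number of states finite.  It loses nothing: by [state_lt] an
    edge in the top state is already a bad event. *)
Definition level (y : R) : 'I_m'.+1 := inord (minn (Num.truncn (`|y| `^ alpha / u)) m').

Lemma levelE y : level y = minn (Num.truncn (`|y| `^ alpha / u)) m' :> nat.
Proof. by rewrite inordK // ltnS geq_minr. Qed.

Let ratio_ge0 (y : R) : 0 <= `|y| `^ alpha / u.
Proof. by rewrite divr_ge0 ?powR_ge0 ?(ltW u_gt0). Qed.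

Lemma level_ge y k : level y = k -> k%:R * u <= `|y| `^ alpha.
Proof.
move=> /(congr1 (@nat_of_ord _)); rewrite levelE => h.
rewrite -ler_pdivlMr //; apply: le_trans (_ : (Num.truncn (`|y| `^ alpha / u))%:R <= _).
  by rewrite ler_nat -h geq_minl.
by rewrite truncn_le.
Qed.

Lemma level_lt y : (level y < m')%N -> `|y| `^ alpha <= u * (level y).+1%:R.
Proof.
rewrite levelE gtn_min ltnn orbF => h.
rewrite (minn_idPl (ltnW h)) mulrC -ler_pdivrMr //.
by have /andP[_ /ltW] := truncn_itv (ratio_ge0 y).
Qed.

Lemma measurable_level k : measurable [set y | level y = k].
Proof.
pose g (y : R) := `|y| `^ alpha / u.
have mg : measurable_fun setT g.
  apply: measurable_funM; last exact: measurable_cst.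
  by apply: (measurableT_comp (measurable_powR alpha)); exact: normr_measurable.
have gi (i : interval R) : measurable [set y | g y \in i].
  by have := mg measurableT _ (measurable_itv i); rewrite setTI.
have [km|km] := ltnP k m'.
- have -> : [set y | level y = k] = [set y | g y \in `[k%:R, k.+1%:R[ ]; last exact: gi.
  apply/seteqP; split=> y /=; rewrite in_itv /= -truncn_eq ?ratio_ge0 //.
    move/(congr1 (@nat_of_ord _)); rewrite levelE => h; move: km; rewrite -h.
    by rewrite gtn_min ltnn orbF => /ltnW/minn_idPl ->.
  move=> /eqP h; apply: val_inj; rewrite /= levelE -/(g y) h.
  exact/minn_idPl/ltnW.
- have -> : [set y | level y = k] = [set y | g y \in `[m'%:R, +oo[ ]; last exact: gi.
  have ek : k = m' :> nat by apply/eqP; rewrite eqn_leq km -ltnS ltn_ord.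
  apply/seteqP; split=> y /=; rewrite in_itv /= andbT -truncn_ge_nat ?ratio_ge0 //.
    move/(congr1 (@nat_of_ord _)); rewrite levelE => h; move: ek; rewrite -h.
    by move/minn_idPr.
  by move=> h; apply: val_inj; rewrite /= levelE ek; exact/minn_idPr.
Qed.

End Levels.

Section LowerBound.
Variables (R : realType) (dO : measure_display) (O : measurableType dO).
Variables (Q : probability O R) (W : {RV Q >-> R}).
Variables (dT : measure_display) (T : measurableType dT) (P : probability T R).
Variables (n : nat) (X Y : 'I_n -> 'I_n -> {RV P >-> R}) (p : R).
Hypothesis hX : erdos_renyi_adjacency X p.
Hypothesis hY : iid_symmetric W Y.
Hypothesis hXY : independent_matrices X Y.
Local Notation Z := (entrywise_product X Y).
Variables (alpha u sigma tau L C2 d t : R) (m' N : nat).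
Local Notation m := m'.+1.
Local Notation lev := (level alpha u m').
Local Notation q := (state_law W p lev).
Hypothesis p01 : 0 <= p <= 1.
Hypotheses (alpha_gt0 : 0 < alpha) (alpha_lt2 : alpha < 2) (u_gt0 : 0 < u).
Hypothesis C2_gt0 : 0 < C2.
Hypothesis tail_le : forall x : R, 1 < x ->
  (Q [set z | (x <= W z)%R] <= (C2 / 2 * expR (- (x `^ alpha)))%:E)%E /\
  (Q [set z | (W z <= - x)%R] <= (C2 / 2 * expR (- (x `^ alpha)))%:E)%E.

(** The state is one more than the level, so [u] times the state is |Z_ij|^alpha
    rounded up, unless the level is the capped one. *)
Lemma state_entry_le w i j : (state (edge_states X Y lev w) i j < m)%N ->
  `|Z w i j| <= (u * (state (edge_states X Y lev w) i j)%:R) `^ alpha^-1.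
Proof.
have [X01 _ sX _ _] := hX; have [_ sY _ _] := hY.
have [-> _|ij] := eqVneq i j.
  by rewrite (entrywise_product_diag Y hX) normr0 powR_ge0.
have [e he] := edge_set_neq ij.
have ein : e \in edge_set i j by rewrite he inE.
have -> : Z w i j = upper X e w * upper Y e w.
  by rewrite mxE /upper; move: ein; rewrite inE => /orP[] /eqP -> //=; rewrite sX sY.
rewrite (state_edge _ ein) ffunE.
case: eqP => [->|X0]; first by rewrite mul0r normr0 powR_ge0.
have -> : upper X e w = 1 by have [] := X01 w (val e).1 (val e).2.
rewrite mul1r /= /bump /= add1n ltnS => /(level_lt u_gt0) h.
set y := upper Y e w in h *.
have -> : `|y| = (`|y| `^ alpha) `^ alpha^-1 by rewrite -powRrM divff ?gt_eqF // powRr1.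
by rewrite ge0_ler_powR ?invr_ge0 ?(ltW alpha_gt0) // nnegrE ?powR_ge0 // mulr_ge0 // ltW.
Qed.

Lemma state_law_le (a : 'I_m.+1) : (0 < a)%N -> 1 < a.-1%:R * u ->
  q a <= p * (C2 * expR (- (a.-1%:R * u))).
Proof.
case/andP: p01 => p0 _; rewrite /state_law.
case: unliftP => [k ->|->] //=; rewrite add0n => _ ku.
rewrite ler_wpM2l //.
pose x := (k%:R * u) `^ alpha^-1.
have xa : x `^ alpha = k%:R * u.
  by rewrite /x -powRrM mulVf ?gt_eqF // powRr1 // (le_trans ler01) // ltW.
have x1 : 1 < x.
  have {1}<- : 1 `^ alpha^-1 = 1 :> R by rewrite powR1.
  rewrite /x gt0_ltr_powR ?invr_gt0 ?nnegrE //.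
  by rewrite (le_trans ler01) // ltW.
have [t1 t2] := tail_le x1; rewrite xa in t1 t2.
have mW (B : set R) : measurable B -> measurable [set z | B (W z)].
  by move=> mB; exact: (measurable_funPTI W mB).
have m1 : measurable [set z | x <= W z].
  rewrite (_ : [set z | x <= W z] = [set z | [set` `[x, +oo[] (W z)]); first exact: mW.
  by apply/seteqP; split=> z; rewrite /= in_itv /= andbT.
have m2 : measurable [set z | W z <= - x].
  rewrite (_ : [set z | W z <= - x] = [set z | [set` `]-oo, - x]] (W z)]); first exact: mW.
  by apply/seteqP; split=> z; rewrite /= in_itv.
have mk := mW _ (measurable_level alpha u_gt0 k).
have : (Q [set z | lev (W z) = k] <= (C2 * expR (- (k%:R * u)))%:E)%E.
  apply: (@le_trans _ _ (Q ([set z | x <= W z] `|` [set z | W z <= - x]))).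
    apply: le_measure; rewrite ?inE //; first exact: measurableU.
    move=> z /= /(level_ge u_gt0) h.
    have : x <= `|W z|.
      have -> : `|W z| = (`|W z| `^ alpha) `^ alpha^-1 by rewrite -powRrM divff ?gt_eqF // powRr1.
      rewrite ge0_ler_powR ?invr_ge0 ?(ltW alpha_gt0) // nnegrE ?powR_ge0 //.
      by rewrite mulr_ge0 // ltW.
    rewrite ler_normr => /orP[|]; first by left.
    by rewrite lerNr; right.
  apply: le_trans (measureU2 _ _ _) _ => //.
  apply: le_trans (leeD t1 t2) _.
  by rewrite -EFinD lee_fin; lra.
by move=> h; rewrite -lee_fin fineK // fin_num_measure.
Qed.

(** Level [k] has probability of order exp (- k u) and its state [k.+1] has weight
    exp (sigma u (k + 1)).  For [k >= N] the product is at most exp (- 2 u), since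
    (1 - sigma) N >= 3 >= 2 + sigma. *)
Lemma heavy_mgf_le : 0 <= sigma -> sigma <= 1 -> 3 <= (1 - sigma) * N%:R -> 1 < N%:R * u ->
  heavy_mgf N q u sigma <= m%:R * (p * C2 * expR (- (2 * u))).
Proof.
move=> s0 s1 N3 Nu; case/andP: (p01) => p0 _.
rewrite /heavy_mgf big_ord_recl /= mul0r mulr0 add0r.
apply: (@le_trans _ _ (\sum_(k < m) p * C2 * expR (- (2 * u)))); last first.
  by rewrite sumr_const card_ord -[leLHS]mulr_natl.
apply: ler_sum => k _; rewrite /= /bump /= add1n ltnS.
case: leqP => [Nk|_]; last by rewrite mul0r mulr0 !mulr_ge0 ?expR_ge0 // ltW.
have Nk' : N%:R <= k%:R :> R by rewrite ler_nat.
have ku : 1 < k%:R * u by apply: lt_le_trans Nu _; rewrite ler_wpM2r // ltW.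
rewrite mul1r.
apply: (@le_trans _ _ (p * (C2 * expR (- (k%:R * u))) * expR (sigma * u * k.+1%:R))).
  rewrite ler_wpM2r ?expR_ge0 //.
  by have := @state_law_le (lift ord0 k); rewrite /= /bump /= add1n; apply.
rewrite -!mulrA -expRD ler_wpM2l // ler_wpM2l ?(ltW C2_gt0) // ler_expR -natr1.
have : (1 - sigma) * N%:R <= (1 - sigma) * k%:R by rewrite ler_wpM2l // subr_ge0.
move=> h; have : 2 + sigma <= (1 - sigma) * k%:R by lra.
move=> h2; have : (2 + sigma) * u <= (1 - sigma) * k%:R * u by rewrite ler_wpM2r // ltW.
lra.
Qed.

Lemma edge_prob_state_law : edge_prob q = p.
Proof.
have := sum_state_law W p (measurable_level alpha (m' := m') u_gt0).
rewrite (bigD1 ord0) //= {1}/state_law unlift_none /edge_prob.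
rewrite (eq_bigl (fun a : 'I_m.+1 => (0 < a)%N)) => [h|a]; first by lra.
by rewrite lt0n.
Qed.

Hypotheses (tau_gt0 : 0 < tau) (L_gt0 : 0 < L).
Hypotheses (sigma0 : 0 <= sigma) (sigma1 : sigma <= 1).
Hypotheses (N3 : 3 <= (1 - sigma) * N%:R) (Nu : 1 < N%:R * u) (Nm : (N < m)%N).
Hypotheses (mu_tau : tau <= m%:R * u) (pn : p * n%:R <= d).
Hypothesis mgf_small : d * C2 * m%:R ^+ 3 * expR (- (2 * u)) <= 1 / 2.
Hypothesis degree_small : degree2_const d * expR (- L) <= 1 / 2.
Hypothesis t_large : (N%:R * u) `^ alpha^-1 * Num.sqrt L + tau `^ alpha^-1 <= t.

(** Off the bad events the entries are dominated by the matrix of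
    [state_form_le], so the largest eigenvalue is at most [t]. *)
Lemma prob_lambda1_le_ge :
  expR (- (2 * (n%:R * expR (- (sigma * tau)) + 1 +
     n%:R * (degree2_const d * expR (- L))))) <=
  fine (P [set w | lambda1 (Z w) <= t]).
Proof.
have t0 : 0 <= t.
  by apply: le_trans t_large; rewrite addr_ge0 ?mulr_ge0 ?powR_ge0.
have mlev := measurable_level alpha (m' := m') u_gt0.
have q0 a := state_law_ge0 W lev a p01.
have q1 := sum_state_law W p mlev.
have ep : edge_prob q * n%:R <= d by rewrite edge_prob_state_law.
have mgf : n%:R * m%:R ^+ 2 * heavy_mgf N q u sigma <= 1 / 2.
  apply: le_trans mgf_small.
  apply: le_trans (ler_wpM2l _ (heavy_mgf_le sigma0 sigma1 N3 Nu)) _.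
    by rewrite mulr_ge0 ?exprn_ge0.
  have -> : n%:R * m%:R ^+ 2 * (m%:R * (p * C2 * expR (- (2 * u)))) =
    (p * n%:R) * (C2 * m%:R ^+ 3 * expR (- (2 * u))) by ring.
  have -> : d * C2 * m%:R ^+ 3 * expR (- (2 * u)) =
    d * (C2 * m%:R ^+ 3 * expR (- (2 * u))) by ring.
  by rewrite ler_wpM2r // !mulr_ge0 ?exprn_ge0 ?expR_ge0 // ltW.
have := pr_good_ge q0 q1 u_gt0 sigma0 tau_gt0 ep mgf degree_small isT.
move/le_trans; apply.
pose G := good N u tau L : pred {ffun upair n -> 'I_m.+1}.
have [mA PA] := edge_states_event hX hY hXY mlev G.
apply: (@le_trans _ _ (fine (P [set w | G (edge_states X Y lev w)]))); first by rewrite PA.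
have mt := measurable_lambda1_le hX hY t0.
apply: fine_le; rewrite ?fin_num_measure //; apply: le_measure; rewrite ?inE //.
move=> w /= gw; apply: lambda1_le => // x.
set f := edge_states X Y lev w in gw; have {}gw : good N u tau L f := gw.
have gl := good_light_trees tau_gt0 gw.
have sl : forall i j, (state f i j < m)%N.
  exact: (@state_lt R 'I_n (state f) N m u tau (state_diag f) u_gt0 Nm mu_tau gl).
apply: (@le_trans _ _ (\sum_i \sum_j (u * (state f i j)%:R) `^ alpha^-1 *
    (`|x 0 i| * `|x 0 j|))).
  rewrite /qform bformE; apply: ler_sum => i _; apply: ler_sum => j _.
  apply: le_trans (ler_norm _) _; rewrite !normrM ler_wpM2r ?mulr_ge0 //.
  exact: state_entry_le (sl i j).
apply: (@le_trans _ _ (t * \sum_i `|x 0 i| ^+ 2)); last first.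
  rewrite sqnormE ler_wpM2l //; apply: ler_sum => i _.
  by rewrite real_normK ?num_real.
apply: le_trans (ler_wpM2r _ t_large); last by apply: sumr_ge0 => i _; exact: exprn_ge0.
apply: (@state_form_le R 'I_n (state f) N m) => //.
- exact: state_sym.
- by have := good_no_cycle u_gt0 gw.
- exact: good_degree gw.
Qed.

End LowerBound.

(** * Asymptotics of the two bounds *)

Lemma near_ln_ge (R : realType) (A : R) : \forall n \near \oo, A <= ln n%:R :> R.
Proof.
near=> n.
have An : expR A <= n%:R by near: n; exact: nbhs_infty_ger.
by rewrite -[leLHS]expRK ler_ln ?posrE ?expR_gt0 // (lt_le_trans _ An) ?expR_gt0.
Unshelve. all: by end_near. Qed.

(** With g = 1/2 - alpha/4 > 0 one has log L = O(L^g), so the left-hand side is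
    O(L^(g/alpha + 1/2)), while 1/alpha = 2 g/alpha + 1/2. *)
Lemma light_negligible (R : realType) (alpha c : R) (N : nat) :
  0 < alpha -> alpha < 2 -> 0 < c ->
  exists B : R, forall L, B <= L ->
    (N%:R * (2 * ln L)) `^ alpha^-1 * Num.sqrt L <= c * L `^ alpha^-1.
Proof.
move=> a0 a2 c0; pose g := 1 / 2 - alpha / 4.
have g0 : 0 < g by rewrite /g; lra.
pose K := (N%:R * (2 / g)) `^ alpha^-1.
have K0 : 0 <= K by exact: powR_ge0.
have NK : 0 <= N%:R * (2 / g) by rewrite mulr_ge0 // divr_ge0 // ltW.
have ga : 0 < g / alpha by rewrite divr_gt0.
exists (1 + (K / c) `^ (g / alpha)^-1) => L BL.
have L1 : 1 <= L by apply: le_trans BL; rewrite lerDl powR_ge0.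
have L0 : 0 < L by exact: lt_le_trans L1.
have lnL : ln L <= L `^ g / g.
  rewrite ler_pdivlMr // mulrC -ln_powR.
  have : 0 < L `^ g by rewrite powR_gt0.
  move: (L `^ g) => x x0; rewrite -ler_expR lnK ?posrE //.
  by apply: le_trans (expR_ge1Dx x); rewrite lerDr.
have h1 : (N%:R * (2 * ln L)) `^ alpha^-1 <= K * L `^ (g / alpha).
  have -> : K * L `^ (g / alpha) = (N%:R * (2 / g) * L `^ g) `^ alpha^-1.
    by rewrite powRM ?powR_ge0 // -powRrM.
  have l0 : 0 <= ln L by rewrite ln_ge0.
  rewrite ge0_ler_powR ?invr_ge0 ?(ltW a0) // ?nnegrE.
  - by rewrite !mulr_ge0.
  - by rewrite mulr_ge0 ?powR_ge0.
  rewrite -mulrA ler_wpM2l // -mulrA ler_wpM2l // mulrC //.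
have h2 : K <= c * L `^ (g / alpha).
  rewrite mulrC -ler_pdivrMr //.
  have -> : K / c = ((K / c) `^ (g / alpha)^-1) `^ (g / alpha).
    by rewrite -powRrM mulVf ?gt_eqF // powRr1 // divr_ge0 // ltW.
  rewrite ge0_ler_powR ?(ltW ga) // ?nnegrE ?powR_ge0 ?(ltW L0) //.
  by apply: le_trans BL; rewrite lerDr.
apply: le_trans (ler_wpM2r (sqrtr_ge0 _) h1) _.
have -> : L `^ alpha^-1 = L `^ (g / alpha) * (L `^ (g / alpha) * Num.sqrt L).
  rewrite -powR12_sqrt ?(ltW L0) // -!powRD ?(gt_eqF L0) ?implybT //.
  by congr (_ `^ _); rewrite /g; field; rewrite gt_eqF.
by rewrite -mulrA [c * _]mulrA ler_wpM2r // mulr_ge0 ?powR_ge0 ?sqrtr_ge0.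
Qed.

Section Asymptotics.
Variables (R : realType) (dO : measure_display) (O : measurableType dO).
Variables (Q : probability O R) (W : {RV Q >-> R}) (d alpha a : R).
Hypotheses (d_gt0 : 0 < d) (alpha_gt0 : 0 < alpha) (alpha_lt2 : alpha < 2).
Hypotheses (a_gt0 : 0 < a) (a_lt1 : a < 1).
Hypothesis hW : weibull W alpha.
Local Notation theta := (a `^ alpha).

Let theta_gt0 : 0 < theta. Proof. exact: powR_gt0. Qed.
Let theta_lt1 : theta < 1.
Proof.
have {1}<- : 1 `^ alpha = 1 :> R by rewrite powR1.
by rewrite gt0_ltr_powR // nnegrE ?ltW.
Qed.

Let scale_powR nu L : 0 <= nu -> 0 <= L ->
  (nu * theta * L) `^ alpha^-1 = nu `^ alpha^-1 * (a * L `^ (1 / alpha)).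
Proof.
move=> nu0 L0; rewrite powRM ?mulr_ge0 ?(ltW theta_gt0) // powRM ?(ltW theta_gt0) //.
by rewrite -powRrM divff ?gt_eqF // powRr1 ?(ltW a_gt0) // div1r mulrA.
Qed.

(** An entry equal to the threshold is compatible with the event.  So the entries
    are compared with the slightly larger [s] defined by s^alpha = nu theta L. *)
Lemma lower_tail_prob_le nu : 1 < nu -> exists2 c : R, 0 < c & exists B : R,
  forall (dT : measure_display) (T : measurableType dT) (P : probability T R) (n : nat)
    (X Y : 'I_n -> 'I_n -> {RV P >-> R}),
    erdos_renyi_adjacency X (d / n%:R) -> iid_symmetric W Y -> independent_matrices X Y ->
    d <= n%:R -> B <= ln n%:R ->
  fine (P [set w | lambda1 (entrywise_product X Y w) <= a * lambda_heavy alpha n]) <=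
  expR (- (c * expR ((1 - nu * theta) * ln n%:R))).
Proof.
move=> nu1; have [C1 [C2 [C10 C20 tails]]] := hW.
have nut0 : 0 < nu * theta by rewrite mulr_gt0 // (lt_trans ltr01).
(* The exponent (d / n) (n^2 / 4) (C1 / 2) n^(- nu theta), where n^2 / 4 bounds the
   number of pairs from below. *)
exists (d * C1 / 8); first by rewrite divr_gt0 // mulr_gt0.
exists (1 + ln 2 + (nu * theta)^-1) => dT T P n X Y hX hY hXY dn BL.
set L := ln n%:R in BL *.
have ln20 : 0 <= ln 2 :> R by rewrite ln_ge0 // ler1n.
have i0 : 0 < (nu * theta)^-1 by rewrite invr_gt0.
have n0 : 0 < n%:R :> R by exact: lt_le_trans dn.
have n2 : (2 <= n)%N by rewrite -(ler_nat R) -ler_ln ?posrE // -/L; lra.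
have L0 : 0 < L by lra.
have L1 : 1 < nu * theta * L.
  by rewrite -ltr_pdivrMl // mulr1; lra.
have nu0 : 0 < nu by exact: lt_trans nu1.
pose s := (nu * theta * L) `^ alpha^-1.
have sa : s `^ alpha = nu * theta * L.
  by rewrite /s -powRrM mulVf ?gt_eqF // powRr1 // (le_trans ler01) // ltW.
have gt1 x : 1 < x -> 1 < x `^ alpha^-1.
  move=> x1; have {1}<- : 1 `^ alpha^-1 = 1 :> R by rewrite powR1.
  by rewrite gt0_ltr_powR ?invr_gt0 ?nnegrE // (le_trans ler01) // ltW.
have s1 : 1 < s by exact: gt1.
have t0 : 0 < a * L `^ (1 / alpha) by rewrite mulr_gt0 ?powR_gt0.
have ts : a * L `^ (1 / alpha) < s.
  by rewrite /s scale_powR ?(ltW nu0) ?(ltW L0) // ltr_pMl // gt1.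
have p01 : 0 <= d / n%:R <= 1.
  by rewrite divr_ge0 ?(ltW d_gt0) //= ler_pdivrMr // mul1r.
rewrite /lambda_heavy -/L.
apply: le_trans (prob_lambda1_le_exp hX hY hXY (ltW t0) ts p01) _.
rewrite ler_expR lerN2 card_upair.
have [/andP[qs _] _] := tails s s1.
have {}qs : C1 / 2 * expR (- (nu * theta * L)) <= fine (Q [set z | s <= W z]).
  rewrite -lee_fin fineK; first by rewrite -sa.
  apply: fin_num_measure; rewrite (_ : [set z | s <= W z] = W @^-1` [set` `[s, +oo[]).
    by apply: measurable_funPTI; exact: measurable_itv.
  by apply/seteqP; split=> z; rewrite /= in_itv /= andbT.
have cn : n%:R ^+ 2 / 4 <= 'C(n, 2)%:R :> R.
  have : (n * n.-1)%:R = (2 * 'C(n, 2))%:R :> R by rewrite -mul_bin_diag bin1.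
  rewrite !natrM -subn1 natrB ?(ltnW n2) //.
  have : 2 <= n%:R :> R by rewrite ler_nat.
  nra.
apply: le_trans (_ : d / n%:R * (C1 / 2 * expR (- (nu * theta * L))) * (n%:R ^+ 2 / 4) <= _); last first.
  have /andP[p0 _] := p01.
  apply: ler_pM => //; rewrite ?mulr_ge0 ?divr_ge0 ?expR_ge0 ?exprn_ge0 ?(ltW C10) ?(ltW d_gt0) //.
  by rewrite ler_wpM2l.
rewrite mulrBl mul1r expRD lnK ?posrE // le_eqVlt; apply/orP; left; apply/eqP.
by field; rewrite gt_eqF.
Qed.

(** The factor [nu] is spent twice: trees are bounded by tau = nu theta L instead
    of theta L to leave room for the light part, and the exponential moment is taken
    at sigma = nu instead of 1, where that of |W|^alpha is infinite. *)
Lemma lower_tail_prob_ge nu : 0 < nu -> nu < 1 -> exists2 C : R, 0 < C & exists B : R,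
  forall (dT : measure_display) (T : measurableType dT) (P : probability T R) (n : nat)
    (X Y : 'I_n -> 'I_n -> {RV P >-> R}),
    erdos_renyi_adjacency X (d / n%:R) -> iid_symmetric W Y -> independent_matrices X Y ->
    d <= n%:R -> B <= ln n%:R ->
  expR (- (C * expR ((1 - nu ^+ 2 * theta) * ln n%:R))) <=
  fine (P [set w | lambda1 (entrywise_product X Y w) <= a * lambda_heavy alpha n]).
Proof.
move=> nu0 nu1; have [C1 [C2 [C10 C20 tails]]] := hW.
have nua : nu `^ alpha^-1 < 1.
  have {1}<- : 1 `^ alpha^-1 = 1 :> R by rewrite powR1.
  by rewrite gt0_ltr_powR ?invr_gt0 ?nnegrE // ltW.
have [N N3] : exists N : nat, 3 <= (1 - nu) * N.+1%:R.
  exists (Num.truncn (3 / (1 - nu))).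
  by rewrite mulrC -ler_pdivrMr ?subr_gt0 // ltW // truncnS_gt.
have [B1 HB1] := @light_negligible R alpha ((1 - nu `^ alpha^-1) * a) N.+1 alpha_gt0 alpha_lt2
  (mulr_gt0 (etrans (subr_gt0 _ _) nua) a_gt0).
pose D := degree2_const d.
have D0 : 0 < D by exact: expR_gt0.
(* The exponent is 2 (n^(1 - nu^2 theta) + 1 + D), and 1 <= n^(1 - nu^2 theta). *)
exists (2 * (2 + D)); first by lra.
exists (`|B1| + expR 1 + N.+2%:R + 16 * d * C2 + 2 * D) => dT T P n X Y hX hY hXY dn BL.
set L := ln n%:R in BL *.
have dC : 0 < 16 * d * C2 by rewrite !mulr_gt0.
have e1 : 0 < expR 1 :> R by exact: expR_gt0.
have B1n := ler_norm B1; have B1n0 := normr_ge0 B1.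
have N0 : 0 <= N.+2%:R :> R by [].
have LB1 : B1 <= L by lra.
have Le : expR 1 <= L by lra.
have LN : N.+2%:R <= L by lra.
have LC : 16 * d * C2 <= L by lra.
have LD : 2 * D <= L by lra.
have L0 : 0 < L by exact: lt_le_trans Le.
have n0 : 0 < n%:R :> R by exact: lt_le_trans dn.
have lnL : 1 <= ln L by rewrite -[leLHS]expRK ler_ln ?posrE.
(* Then expR (- (2 * u)) = L^-4 beats the factor m^3 = O(L^3) of the union bound. *)
pose u := 2 * ln L.
have u0 : 0 < u by rewrite /u; lra.
(* Both the number of levels and the largest size of a tree are of order L:
   heavy edges weigh at least 1, so a tree of size m reaches tau <= L. *)
pose m' := (Num.truncn L + N.+1)%N.
have /andP[m1 m2] : L <= m'.+1%:R <= 2 * L.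
  have /andP[h1 h2] := truncn_itv (ltW L0).
  have -> : m'.+1%:R = (Num.truncn L)%:R + N.+2%:R :> R by rewrite -natrD /m' !addnS.
  have h3 : 1 <= N.+2%:R :> R by rewrite ler1n.
  by move: h2; rewrite -[(Num.truncn L).+1%:R]natr1 => h2; apply/andP; split; lra.
have p01 : 0 <= d / n%:R <= 1.
  by rewrite divr_ge0 ?(ltW d_gt0) //= ler_pdivrMr // mul1r.
have nuth : nu * theta <= 1.
  by rewrite mulr_ile1 ?(ltW nu0) ?(ltW nu1) ?(ltW theta_gt0) ?(ltW theta_lt1).
have tau0 : 0 < nu * theta * L by rewrite !mulr_gt0.
have eu : expR (- (2 * u)) = (L ^+ 4)^-1.
  by rewrite expRN /u mulrA -natrM mulrC expRM_natr lnK ?posrE.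
have := @prob_lambda1_le_ge R dO O Q W dT T P n X Y (d / n%:R) hX hY hXY alpha u nu
  (nu * theta * L) L C2 d (a * L `^ (1 / alpha)) m' N.+1 p01 alpha_gt0 alpha_lt2 u0 C20.
rewrite /lambda_heavy -/L => H.
have n_exp : n%:R = expR L by rewrite lnK ?posrE.
have Dn : n%:R * (D * expR (- L)) = D.
  by rewrite n_exp mulrCA -expRD subrr expR0 mulr1.
apply: le_trans (H _ tau0 L0 (ltW nu0) (ltW nu1) N3 _ _ _ _ _ _ _).
- rewrite ler_expR lerN2 -/D Dn n_exp -expRD.
  have -> : L + - (nu * (nu * theta * L)) = (1 - nu ^+ 2 * theta) * L by ring.
  have : 1 <= expR ((1 - nu ^+ 2 * theta) * L).
    rewrite -[leLHS]expR0 ler_expR mulr_ge0 ?(ltW L0) // subr_ge0 expr2 -mulrA.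
    by rewrite mulr_ile1 ?(ltW nu0) ?(ltW nu1) // mulr_ge0 ?(ltW nu0) ?(ltW theta_gt0).
  move: (expR _) => x x1; have : D * 1 <= D * x by rewrite ler_wpM2l // ltW.
  lra.
- by move=> x /tails[/andP[_ h1] /andP[_ h2]]; split.
- have : 1 <= N.+1%:R :> R by rewrite ler1n.
  rewrite /u; nra.
- by rewrite /m' ltnS leq_addl.
- apply: (@le_trans _ _ (m'.+1%:R * 1)); last by rewrite ler_wpM2l // /u; lra.
  rewrite mulr1; apply: le_trans m1.
  by rewrite -[leRHS]mul1r ler_wpM2r // ltW.
- by rewrite mulfVK // gt_eqF.
- rewrite eu ler_pdivrMr ?exprn_gt0 //.
  have m3 : m'.+1%:R ^+ 3 <= (2 * L) ^+ 3 by rewrite lerXn2r ?nnegrE // mulr_ge0 // ltW.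
  apply: le_trans (_ : d * C2 * (2 * L) ^+ 3 <= _).
    by rewrite ler_wpM2l // mulr_ge0 ?ltW.
  have -> : d * C2 * (2 * L) ^+ 3 = (16 * d * C2) * L ^+ 3 / 2 by field.
  have -> : 1 / 2 * L ^+ 4 = L * L ^+ 3 / 2 by field.
  by rewrite ler_wpM2r // ler_wpM2r // exprn_ge0 // ltW.
- rewrite -/D expRN ler_pdivrMr ?expR_gt0 //.
  have := expR_ge1Dx L; lra.
- have := HB1 _ LB1; rewrite scale_powR ?(ltW nu0) ?(ltW L0) // -/u !div1r; lra.
Qed.

End Asymptotics.

(** * The limit *)

(** The constants [ln c] and [ln C] are negligible against [L]. *)
Lemma loglog_bounds (R : realType) (c C b B L x : R) :
  0 < c -> 0 < C ->
  expR (- (C * expR (B * L))) <= x -> x <= expR (- (c * expR (b * L))) ->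
  ln c + b * L <= ln (ln (1 / x)) <= ln C + B * L.
Proof.
move=> c0 C0 xl xu.
have x0 : 0 < x by apply: lt_le_trans xl; exact: expR_gt0.
have -> : ln (1 / x) = - ln x by rewrite div1r lnV ?posrE.
have h1 : c * expR (b * L) <= - ln x.
  by rewrite lerNr -[leRHS]expRK ler_ln ?posrE ?expR_gt0.
have h2 : - ln x <= C * expR (B * L).
  by rewrite lerNl -[leLHS]expRK ler_ln ?posrE ?expR_gt0.
have lx : 0 < - ln x by apply: lt_le_trans h1; rewrite mulr_gt0 ?expR_gt0.
have E k y : 0 < k -> ln k + y = ln (k * expR y).
  by move=> k0; rewrite lnM ?posrE ?expR_gt0 // expRK.
by rewrite !E // !ler_ln ?posrE ?mulr_gt0 ?expR_gt0 // h1.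
Qed.

Theorem theorem1p6 (R : realType) (d alpha : R)
  (hd : 0 < d) (halpha0 : 0 < alpha) (halpha2 : alpha < 2)
  (dO : measure_display) (O : measurableType dO) (Q : probability O R)
  (W : {RV Q >-> R}) (hW : weibull W alpha)
  (dT : nat -> measure_display) (T : forall n : nat, measurableType (dT n))
  (P : forall n : nat, probability (T n) R)
  (X Y : forall n : nat, 'I_n -> 'I_n -> {RV (P n) >-> R})
  (hX : forall n : nat, d <= n%:R -> erdos_renyi_adjacency (X n) (d / n%:R))
  (hY : forall n : nat, d <= n%:R -> iid_symmetric W (Y n))
  (hXY : forall n : nat, d <= n%:R -> independent_matrices (X n) (Y n))
  (delta : R) (hdelta0 : 0 < delta) (hdelta1 : delta < 1) :
  (fun n : nat =>
     1 / ln n%:R *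
     ln (ln (1 / fine (P n [set w | lambda1 (entrywise_product (X n) (Y n) w)
                                      <= (1 - delta) * lambda_heavy alpha n]))))
    @ \oo --> 1 - (1 - delta) `^ alpha.
Proof.
set a := 1 - delta.
have a0 : 0 < a by rewrite /a; lra.
have a1 : a < 1 by rewrite /a; lra.
set theta := a `^ alpha.
have th0 : 0 < theta by exact: powR_gt0.
have th1 : theta < 1.
  have {1}<- : 1 `^ alpha = 1 :> R by rewrite powR1.
  by rewrite gt0_ltr_powR // nnegrE ltW.
apply/cvgrPdist_le => e e0.
pose e' := Num.min (e / 2) 1.
have e'0 : 0 < e' by rewrite /e' lt_min; apply/andP; split; lra.
have [e'1 e'e] : e' <= 1 /\ e' <= e / 2 by rewrite /e'; split; rewrite ge_min lexx ?orbT.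
(* Chosen so that nu1 theta and nu2^2 theta are within e / 2 of theta, while
   nu1 > 1 > nu2. *)
pose nu1 := 1 + e' / theta; pose nu2 := 1 - e' / 2.
have nu1_gt1 : 1 < nu1 by rewrite /nu1 ltrDl divr_gt0.
have nu1E : nu1 * theta = theta + e' by rewrite /nu1 mulrDl mul1r divfK ?gt_eqF.
have nu2_gt0 : 0 < nu2 by rewrite /nu2; lra.
have nu2_lt1 : nu2 < 1 by rewrite /nu2; lra.
have nu2E : theta - e' <= nu2 ^+ 2 * theta.
  have : (1 - e') * theta <= nu2 ^+ 2 * theta.
    by rewrite ler_wpM2r ?(ltW th0) // /nu2; have := sqr_ge0 (e' / 2); nra.
  have : e' * theta <= e' by rewrite ler_piMr ?ltW.
  lra.
have [c c0 [B1 H1]] := lower_tail_prob_le hd halpha0 a0 hW nu1_gt1.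
have [C C0 [B2 H2]] := lower_tail_prob_ge hd halpha0 halpha2 a0 a1 hW nu2_gt0 nu2_lt1.
near=> n.
have dn : d <= n%:R by near: n; exact: nbhs_infty_ger.
have L1 : B1 <= ln n%:R by near: n; exact: near_ln_ge.
have L2 : B2 <= ln n%:R by near: n; exact: near_ln_ge.
have L3 : 1 <= ln n%:R :> R by near: n; exact: near_ln_ge.
have Lc : (`|ln c| + `|ln C|) / (e / 2) <= ln n%:R by near: n; exact: near_ln_ge.
have := H2 _ _ _ _ _ _ (hX n dn) (hY n dn) (hXY n dn) dn L2.
have := H1 _ _ _ _ _ _ (hX n dn) (hY n dn) (hXY n dn) dn L1.
set x := fine _; set L := ln n%:R in L1 L2 L3 Lc *.
move=> up lo.
have /andP[] := loglog_bounds c0 C0 lo up.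
rewrite -/theta nu1E div1r; set y := ln (ln _) => y1 y2.
have L0 : 0 < L by lra.
move: Lc; rewrite ler_pdivrMr ?divr_gt0 // => Lc.
have n1 := ler_norm (ln C); have n2 := ler_norm (- ln c); rewrite normrN in n2.
have n3 := normr_ge0 (ln C); have n4 := normr_ge0 (ln c).
have ee : L * e' <= L * (e / 2) by rewrite ler_wpM2l // ltW.
have z1 : (1 - theta - e) * L <= y by lra.
have z2 : y <= (1 - theta + e) * L.
  have : (1 - nu2 ^+ 2 * theta) * L <= (1 - (theta - e')) * L.
    by rewrite ler_wpM2r ?(ltW L0) //; lra.
  lra.
have w1 : 1 - theta - e <= L^-1 * y by rewrite mulrC ler_pdivlMr.
have w2 : L^-1 * y <= 1 - theta + e by rewrite mulrC ler_pdivrMr.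
by rewrite ler_norml; apply/andP; split; lra.
Unshelve. all: by end_near. Qed.
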